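(* Suppose $w$ satisfies (A1), and that (A2s) and (A3) hold for every $\delta\in(0,1/2)$. Let $f\in L^2(\Omega)$, let $u_0\in H^1_0(\Omega)$ be the weak solution of $-u''=f$ in $\Omega$, $u(0)=u(1)=0$, and for $\delta$ sufficiently small let $u_\delta\in L^2(\Omega)$ be the solution of $\widetilde{\mathcal N}_\delta u_\delta=f$. Then $\lim_{\delta\to0}\|u_\delta-u_0\|_{L^2(\Omega)}=0$.
   Context: Throughout, $\Omega=(0,1)$, $\delta\in(0,1/2)$, $|\cdot|$ applied to a set denotes Lebesgue measure, and $\chi_A$ denotes the indicator function of a set $A$. A function $w:[0,\infty)\to[0,\infty)$ satisfies (A1) if $w$ is continuous and nonincreasing on $[0,1)$, positive on $(0,1)$, $w(r)=0$ for $r\ge 1$, and $\int_{\mathbb R} w(|z|)|z|^2\,dz=2$. Set $w_\delta(x,y)=\delta^{-3}w(|x-y|/\delta)$, $a_\delta(x)=\int_0^1 w_\delta(x,y)\,dy$, and $b_\delta(x)=\frac{2}{(x+\delta)^2}\int_{x-\delta}^{0}(x-y)w_\delta(x,y)\,dy$ for $x\in(0,\delta)$, $b_\delta(x)=\frac{2}{(1-x+\delta)^2}\int_{1}^{x+\delta}(y-x)w_\delta(x,y)\,dy$ for $x\in(1-\delta,1)$, and $b_\delta(x)=0$ otherwise. The operator $\widetilde{\mathcal N}_\delta$ on $L^2(\Omega)$ is $\widetilde{\mathcal N}_\delta u(x)=a_\delta(x)u(x)-\int_0^1 u(y)\big(w_\delta(x,y)-b_\delta(x)\chi_{[0,\delta]}(|y-x|)\big)\,dy$.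 Define $\widetilde w_\delta(x,y)=|w_\delta(x,y)-b_\delta(x)\chi_{(0,\delta)}(|y-x|)|$. Condition (A2s) (for a given $\delta$): for every $x\in\Omega$, $|\{y\in\Omega: w_\delta(x,y)-b_\delta(x)\chi_{[0,\delta]}(|y-x|)\ge 0\}|\ge|\{y\in\Omega: w_\delta(x,y)-b_\delta(x)\chi_{[0,\delta]}(|y-x|)\le 0\}|$. Condition (A3) (for a given $\delta$): $a_\delta(x)\ge\int_0^1\widetilde w_\delta(y,x)\,dy$ for all $x\in\Omega$. *)

(* Defs.v *)
From HB Require Import structures.
From mathcomp Require Import all_boot all_order all_algebra.
From mathcomp Require Import all_classical all_reals all_analysis.
Set Implicit Arguments. Unset Strict Implicit. Unset Printing Implicit Defensive.
Import Order.TTheory GRing.Theory Num.Theory.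
Import numFieldNormedType.Exports.
Local Open Scope classical_set_scope.
Local Open Scope ring_scope.

Section Defs.
Variable R : realType.
Notation mu := (@lebesgue_measure R).

Definition Omega : set R := `]0, 1[.

Definition A1 (w : R -> R) : Prop :=
  {within `[0, 1[, continuous w} /\
  (forall r s : R, 0 <= r -> r <= s -> s < 1 -> w s <= w r) /\
  (forall r : R, 0 < r < 1 -> 0 < w r) /\
  (forall r : R, 1 <= r -> w r = 0) /\
  (forall r : R, 0 <= r -> 0 <= w r) /\
  (\int[mu]_(z in [set: R]) (w `|z| * `|z| ^+ 2)%:E = 2%:E)%E.

Definition wd (w : R -> R) (d x y : R) : R := d ^- 3 * w (`|x - y| / d).

Definition ad (w : R -> R) (d x : R) : R := Rintegral mu Omega (fun y => wd w d x y).

Definition bd (w : R -> R) (d x : R) : R :=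
  if (0 < x) && (x < d) then
    2 / (x + d) ^+ 2 * Rintegral mu `[x - d, 0] (fun y => (x - y) * wd w d x y)
  else if (1 - d < x) && (x < 1) then
    2 / (1 - x + d) ^+ 2 * Rintegral mu `[1, x + d] (fun y => (y - x) * wd w d x y)
  else 0.

Definition Kd (w : R -> R) (d x y : R) : R :=
  wd w d x y - bd w d x * (if `|y - x| <= d then 1 else 0).

Definition Nd (w : R -> R) (d : R) (u : R -> R) (x : R) : R :=
  ad w d x * u x - Rintegral mu Omega (fun y => u y * Kd w d x y).

Definition wtd (w : R -> R) (d x y : R) : R :=
  `|wd w d x y - bd w d x * (if (0 < `|y - x|) && (`|y - x| < d) then 1 else 0)|.

Definition A2s (w : R -> R) (d : R) : Prop :=
  forall x, Omega x ->
    (mu [set y | Omega y /\ (0 <= Kd w d x y)%R] >= mu [set y | Omega y /\ (Kd w d x y <= 0)%R])%E.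

Definition A3 (w : R -> R) (d : R) : Prop :=
  forall x, Omega x ->
    ((ad w d x)%:E >= \int[mu]_(y in Omega) (wtd w d y x)%:E)%E.

Definition L2 (f : R -> R) : Prop :=
  measurable_fun Omega f /\ (\int[mu]_(x in Omega) (f x ^+ 2)%:E < +oo)%E.

(* v in H^1_0(Omega) with weak derivative g: v = int_0^x g a.e., g in L^2,
   int_0^1 g = 0 (so v(0) = v(1) = 0 for the continuous representative). *)
Definition H10_with_deriv (v g : R -> R) : Prop :=
  L2 v /\ L2 g /\ Rintegral mu Omega g = 0 /\
  {ae mu, forall x, Omega x -> v x = Rintegral mu `[0, x] g}.

Definition weak_solution (f u0 : R -> R) : Prop :=
  exists g0, H10_with_deriv u0 g0 /\
    forall v h, H10_with_deriv v h ->
      Rintegral mu Omega (fun x => g0 x * h x) = Rintegral mu Omega (fun x => f x * v x).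

Definition L2dist (u v : R -> R) : R :=
  Num.sqrt (Rintegral mu Omega (fun x => (u x - v x) ^+ 2)).

End Defs.

(* Main.v *)
Require Import Defs.
From HB Require Import structures.
From mathcomp Require Import all_boot all_order all_algebra.
From mathcomp Require Import all_classical all_reals all_analysis.
From mathcomp Require Import measurable_realfun ring lra.
Set Implicit Arguments. Unset Strict Implicit. Unset Printing Implicit Defensive.
Import Order.TTheory GRing.Theory Num.Theory.
Import numFieldNormedType.Exports.
Local Open Scope classical_set_scope.
Local Open Scope ring_scope.

(** Consistency plus stability.

    Stability: the Dirichlet form of [Nd] is bounded below by a Schur test. A2s
    says that at most half of the window [|y - x| <= d] carries negative values
    of the kernel, so that row sums of [|Kd|] are at most [ad], with a gain of
    order [d^-2] in the boundary layers where [bd] is of order [d^-3]; A3 bounds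
    the column sums. In the interior there is no slack to spare, and coercivity
    comes from unequal Schur weights: a pair [(x, y)] with [y] to the left of
    [x] is weighted with a factor depending on a slowly decreasing linear
    function of [x]. Its slope produces a gain independent of [d], and the
    boundary layers absorb the loss at the ends.

    Consistency: for [v] with [- v'' = g] continuous, Taylor's formula gives
    [Nd v = g + o(1)] in the interior, while in the layers (of measure [2 d])
    the first order terms cancel by the choice of [bd] and [Nd v] stays bounded.

    The general case follows by approximating [f] in [L2] by continuous [g],
    with [||u0 - v|| <= ||f - g||] from the weak formulation. *)

(** * Integration on the real line *)

(** [Kd] is neither symmetric nor of one sign, so its quadratic form is not a sum of squared
    differences, and equal Schur weights yield only nonnegativity in the interior. On pairs at
    distance comparable to [d] the kernel has size [d^-3], so a row sum over them is of order
    [d^-2]; a gain of order 1 asks for a relative change of weights of order [d^2]. If the weight is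
    tilted with slope [eps], a shift by a multiple of [d] yields a multiple of [eps * d], while the
    condition on the product of the two weights costs a multiple of [eps^2]. Hence [eps] is a small
    multiple of [d], and both terms have the required order. In a layer the tilt is not compensated
    and costs order [d^-1], which loses against [d^-2] once [d] is small. The consistency error in
    the layers is only bounded; it is its [L2] norm that tends to 0, which is why stability is an
    [L2] estimate. *)

Section Toolkit.
Variable R : realType.
Local Notation mu := (@lebesgue_measure R).
Local Notation Lint D f := (mu.-integrable D (EFin \o f)).
(* [lebesgue_measure] lives on [measurableTypeR R], which is convertible but not
   syntactically equal to the default measurable structure of [R]. *)
Local Notation T := (measurableTypeR R).
Implicit Types (D E : set T) (f g h : T -> R).

Lemma measurable_Omega : measurable (@Omega R : set T).
Proof. exact: measurable_itv. Qed.

Lemma mu_Omega : mu (@Omega R) = 1%E.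
Proof. by rewrite lebesgue_measure_itv/= lte_fin ltr01 sube0. Qed.

Lemma int_meas D f : Lint D f -> measurable_fun D f.
Proof. by move=> /integrableP[/measurable_EFinP]. Qed.

Lemma int_dom D f g : measurable D -> measurable_fun D f -> Lint D g ->
  (forall x, D x -> `|f x| <= g x) -> Lint D f.
Proof.
move=> mD mf ig fg; apply: le_integrable ig => //; first exact/measurable_EFinP.
move=> x Dx /=; rewrite lee_fin (le_trans (fg _ Dx))// ler_norm //.
Qed.

Lemma int_bnd D f C : measurable D -> (mu D < +oo)%E -> measurable_fun D f ->
  (forall x, D x -> `|f x| <= C) -> Lint D f.
Proof.
move=> mD Dfin mf fC; apply: (@int_dom _ _ (cst C)) => //.
apply/integrableP; split; first exact/measurable_EFinP.
rewrite (@eq_integral _ _ _ mu D (cst `|C|%:E)) ?integral_cst//.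
by apply: lte_mul_pinfty => //; rewrite ?lee_fin.
Qed.

Lemma int_add D f g : measurable D -> Lint D f -> Lint D g ->
  Lint D (fun x => f x + g x).
Proof. by move=> mD If Ig; exact: (integrableD mD If Ig). Qed.

Lemma int_sub D f g : measurable D -> Lint D f -> Lint D g ->
  Lint D (fun x => f x - g x).
Proof. by move=> mD If Ig; exact: (integrableB mD If Ig). Qed.

Lemma int_scale D c f : measurable D -> Lint D f -> Lint D (fun x => c * f x).
Proof. by move=> mD If; exact: (integrableZl mD c If). Qed.

Lemma int_abs D f : Lint D f -> Lint D (fun x => `|f x|).
Proof. exact: integrable_norm. Qed.

Lemma int_mulb D f g C : measurable D -> Lint D f -> measurable_fun D g ->
  (forall x, D x -> `|g x| <= C) -> Lint D (fun x => g x * f x).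
Proof.
move=> mD If mg gC.
apply: (@int_dom _ _ (fun x => C * `|f x|)) => //.
- by apply: measurable_funM => //; exact: int_meas.
- by apply: int_scale => //; exact: int_abs.
- by move=> x Dx; rewrite normrM ler_wpM2r// gC.
Qed.

Lemma eq_int D f g : measurable D -> (forall x, D x -> f x = g x) -> Lint D f -> Lint D g.
Proof. by move=> mD fg; apply: eq_integrable => // x /set_mem Dx /=; rewrite fg. Qed.

Lemma RI_eq D f g : (forall x, D x -> f x = g x) ->
  Rintegral mu D f = Rintegral mu D g.
Proof. by move=> fg; apply: eq_Rintegral => x /set_mem; exact: fg. Qed.

Lemma RI_abs_le D f g : measurable D -> measurable_fun D f -> Lint D g ->
  (forall x, D x -> `|f x| <= g x) -> `|Rintegral mu D f| <= Rintegral mu D g.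
Proof.
move=> mD mf ig fg; have If := int_dom mD mf ig fg.
apply: (le_trans (le_normr_Rintegral _ _)) => //.
by apply: le_Rintegral => //; exact: int_abs.
Qed.

Lemma int_restr D E f : measurable D -> measurable E -> D `<=` E ->
  (forall x, E x -> ~ D x -> f x = 0) -> Lint D f <-> Lint E f.
Proof.
move=> mD mE DE f0; rewrite (integrable_mkcond _ mD) (integrable_mkcond _ mE).
suff -> : ((EFin \o f) \_ D) = ((EFin \o f) \_ E) by [].
apply/funext => x; rewrite !patchE.
case: ifPn => [/set_mem Dx|/negP Dx]; first by rewrite mem_set//; exact: DE.
case: ifPn => // /set_mem Ex; rewrite /= f0// => Dx'; apply: Dx; exact: mem_set.
Qed.

Lemma RI_restr D E f : D `<=` E -> (forall x, E x -> ~ D x -> f x = 0) ->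
  Rintegral mu D f = Rintegral mu E f.
Proof.
move=> DE f0; rewrite (Rintegral_mkcond _ D) (Rintegral_mkcond _ E).
apply: RI_eq => x _; rewrite !patchE.
case: ifPn => [/set_mem Dx|/negP Dx]; first by rewrite mem_set//; exact: DE.
case: ifPn => // /set_mem Ex; rewrite /= f0// => Dx'; apply: Dx; exact: mem_set.
Qed.

Lemma RI_ind D (P : T -> bool) : measurable D -> measurable [set y | D y /\ P y] ->
  Rintegral mu D (fun y => (P y)%:R) = fine (mu [set y | D y /\ P y]).
Proof.
move=> mD mP; have := @Rintegral_cst _ _ _ mu _ mP 1; rewrite mul1r => <-.
rewrite -(@RI_restr [set y | D y /\ P y] D); last 2 first.
- by move=> x [].
- by move=> x Dx DP; case: (boolP (P x)) => // Px; case: DP.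
by apply: eq_Rintegral => x /set_mem [_ ->].
Qed.

Lemma RI_cst_Omega c : Rintegral mu (@Omega R) (cst c) = c.
Proof.
rewrite Rintegral_cst; last exact: measurable_Omega.
have -> : fine (mu (@Omega R)) = 1 by rewrite mu_Omega.
by rewrite mulr1.
Qed.

Lemma RI_le_ae D f g : measurable D -> Lint D f -> Lint D g ->
  {ae mu, forall x, D x -> f x <= g x} -> Rintegral mu D f <= Rintegral mu D g.
Proof.
move=> mD If Ig fg; rewrite -subr_ge0 -RintegralB//.
have Ih : Lint D (fun x => g x - f x) by exact: int_sub.
have mh := int_meas Ih.
(* A function that is nonnegative almost everywhere agrees almost everywhere with its absolute
   value, whose integral is nonnegative. *)
have -> : Rintegral mu D (fun x => g x - f x) = Rintegral mu D (fun x => `|g x - f x|).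
  rewrite /Rintegral; congr fine; apply: ae_eq_integral => //.
  - exact/measurable_EFinP.
  - by apply/measurable_EFinP; apply: measurableT_comp.
  - apply: filterS fg => x fgx Dx; congr EFin; rewrite ger0_norm// subr_ge0; exact: fgx.
by apply: Rintegral_ge0.
Qed.

Lemma RI_eq_ae D f g : measurable D -> measurable_fun D f -> measurable_fun D g ->
  {ae mu, forall x, D x -> f x = g x} -> Rintegral mu D f = Rintegral mu D g.
Proof.
move=> mD mf mg fg; rewrite /Rintegral; congr fine; apply: ae_eq_integral => //.
- exact/measurable_EFinP.
- exact/measurable_EFinP.
- by apply: filterS fg => x fgx Dx; congr EFin; exact: fgx.
Qed.

Section Push.
Variables (phi : T -> T) (k : R).
Hypotheses (mphi : measurable_fun setT phi) (k0 : 0 < k).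
Hypothesis phiE : forall a b : R, a < b ->
    (mu `]a, b]%classic = k%:E * mu (phi @^-1` `]a, b]%classic))%E.

Let k' : {nonneg R} := NngNum (ltW k0).
Let pm : {measure set T -> \bar R} :=
  measure_function_pushforward__canonical__measure_function_Measure mu mphi.
Let nu : {measure set T -> \bar R} := mscale k' pm.

(** By [phiE], [k] times the image of [mu] under [phi] agrees with [mu] on half-open intervals,
    hence on all measurable sets; it remains to change variables in an image measure. Dilations and
    reflections are both instances. *)
Lemma ge0_integral_push (F : T -> \bar R) : measurable_fun setT F ->
  (forall x, 0 <= F x)%E ->
  (\int[mu]_x F x = k%:E * \int[mu]_x F (phi x))%E.
Proof.
move=> mF F0.
have nuE A : measurable A -> mu A = nu A.
  move=> mA; apply: lebesgue_measure_unique => // X [[a b] _ <-] /=.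
  have [ab|ba] := ltP a b; first exact: phiE.
  by rewrite !set_itv_ge ?measure0 -?leNgt ?bnd_simp.
rewrite (@eq_measure_integral _ _ _ setT nu mu); last by move=> A mA _; exact: nuE.
rewrite ge0_integral_mscale//.
rewrite (_ : (\int[pm]_x F x)%E = (\int[pushforward mu phi]_x F x)%E) //.
by rewrite ge0_integral_pushforward.
Qed.

Lemma RI_push f : Lint setT f ->
  Lint setT (f \o phi) /\
  Rintegral mu setT f = k * Rintegral mu setT (f \o phi).
Proof.
move=> If; have mf := int_meas If.
have mfE : measurable_fun setT (EFin \o f) by exact/measurable_EFinP.
have Ip : Lint setT (f \o phi).
  apply/integrableP; split.
    by apply/measurable_EFinP; exact: measurableT_comp.
  move/integrableP: If => [_].
  rewrite (@ge0_integral_push (fun x => `|(f x)%:E|%E)) //; last exact: measurableT_comp.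
  have -> : (\int[mu]_x `|(EFin \o (f \o phi)) x| = \int[mu]_x `|(f (phi x))%:E|)%E by [].
  (* Since [k > 0], an infinite integral would stay infinite after multiplication by [k]. *)
  move: (\int[mu]_x _)%E => [r| |] //=; first by rewrite !ltry.
  by rewrite gt0_muley ?lte_fin// ltxx.
split => //.
rewrite /Rintegral integralE [in RHS]integralE.
rewrite (@ge0_integral_push (fun x => ((EFin \o f)^\+ x)%E)) //; last exact: measurable_funepos.
rewrite (@ge0_integral_push (fun x => ((EFin \o f)^\- x)%E)) //; last exact: measurable_funeneg.
have Pf := integrable_pos_fin_num measurableT Ip; have Nf := integrable_neg_fin_num measurableT Ip.
(* [fine] commutes with the difference only for finite values; integrability of [f \o phi] supplies
   them. *)
have key (A B : \bar R) : (A \is a fin_num -> B \is a fin_num ->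
    fine (k%:E * A - k%:E * B)%E = k * fine (A - B)%E)%R.
  by move=> /fineK <- /fineK <-; rewrite -!EFinM -!EFinB /= mulrBr.
transitivity (fine (k%:E * \int[mu]_x (EFin \o (f \o phi))^\+ x - k%:E * \int[mu]_x (EFin \o (f \o phi))^\- x)%E).
  by congr (fine (_ * _ - _ * _)%E); apply: eq_integral => x _; rewrite !(funeposE, funenegE).
exact: (key _ _ Pf Nf).
Qed.

End Push.

Lemma RI_scale (c e : R) f : 0 < c -> Lint setT f ->
  Lint setT (fun y => f (c * y + e)) /\
  Rintegral mu setT f = c * Rintegral mu setT (fun y => f (c * y + e)).
Proof.
move=> c0 If; apply: (@RI_push (fun y => c * y + e)) => //.
  by apply: measurable_funD => //; exact: measurable_funM.
move=> a b ab.
have -> : (fun y : R => c * y + e) @^-1` `]a, b] = `](a - e) / c, (b - e) / c]%classic.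
  apply/seteqP; split => y /=; rewrite !in_itv/= ltr_pdivrMr// ler_pdivlMr//;
    rewrite ltrBlDr lerBrDr mulrC //.
rewrite !lebesgue_measure_itv/= !lte_fin ab ltr_pM2r ?invr_gt0// ltrD2r ab.
by rewrite -!EFinB -EFinM; congr EFin; field; rewrite gt_eqF.
Qed.

Lemma RI_refl (e : R) f : Lint setT f ->
  Lint setT (fun y => f (e - y)) /\
  Rintegral mu setT f = Rintegral mu setT (fun y => f (e - y)).
Proof.
move=> If; rewrite -[X in _ /\ _ = X]mul1r.
apply: (@RI_push (fun y => e - y)) => //.
  exact: measurable_funB.
move=> a b ab; rewrite mul1e.
have -> : (fun y : R => e - y) @^-1` `]a, b] = `[e - b, e - a[%classic.
  by apply/seteqP; split => y /=; rewrite !in_itv/= => /andP[h1 h2]; apply/andP; split; lra.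
rewrite !lebesgue_measure_itv/= !lte_fin ab ltrD2l ltrN2 ab.
by rewrite -!EFinB; congr EFin; ring.
Qed.

Lemma RI_refl_Omega f : Lint (@Omega R) f ->
  Lint (@Omega R) (fun y => f (1 - y)) /\
  Rintegral mu (@Omega R) f = Rintegral mu (@Omega R) (fun y => f (1 - y)).
Proof.
move=> If; have mO := measurable_Omega.
have If' : Lint setT (f \_ (@Omega R : set T)).
  by rewrite -restrict_EFin; apply/(integrable_mkcond _ mO).
have E (y : T) : (f \_ (@Omega R)) (1 - y) = ((fun y => f (1 - y)) \_ (@Omega R)) y.
  rewrite !patchE; suff -> : (1 - y \in @Omega R) = (y \in @Omega R) by [].
  apply/idP/idP => /set_mem; rewrite /Omega /= in_itv/= => /andP[h1 h2];
    by apply/mem_set; rewrite /Omega /= in_itv/=; apply/andP; split; lra.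
have [I1 e1] := RI_refl 1 If'; split.
  apply/integrable_mkcond => //; rewrite restrict_EFin.
  by apply: eq_int I1 => // y _; exact: E.
rewrite Rintegral_mkcond e1 [RHS]Rintegral_mkcond.
by apply: RI_eq => y _; exact: E.
Qed.

End Toolkit.

(** * Fubini's theorem on the unit square *)

Section FubiniOmega.
Variable R : realType.
Local Notation mu := (@lebesgue_measure R).
Local Notation Lint D f := (mu.-integrable D (EFin \o f)).
Local Notation T := (measurableTypeR R).
Local Notation Om := (@Omega R : set T).
Implicit Types (D E : set T) (f g h : T -> R).

Lemma mOm : measurable Om. Proof. exact: measurable_Omega. Qed.

Lemma mOmOm : measurable (Om `*` Om). Proof. by apply: measurableX; exact: mOm. Qed.

Lemma meas_fst f : measurable_fun Om f ->
  measurable_fun (Om `*` Om) (fun z : T * T => f z.1).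
Proof.
move=> mf; apply: (measurable_comp mOm _ mf); first by move=> _ [z [z1 z2] <-].
by apply: measurable_funTS; exact: measurable_fst.
Qed.

Lemma meas_snd f : measurable_fun Om f ->
  measurable_fun (Om `*` Om) (fun z : T * T => f z.2).
Proof.
move=> mf; apply: (measurable_comp mOm _ mf); first by move=> _ [z [z1 z2] <-].
by apply: measurable_funTS; exact: measurable_snd.
Qed.

Section Fubini.
Variables (F : T -> T -> R) (h : T -> R).
Hypothesis mF : measurable_fun (Om `*` Om) (fun z => F z.1 z.2).
Hypothesis Ih : Lint Om h.
Hypothesis Fh : forall x y, Om x -> Om y -> `|F x y| <= h x + h y.

(** Extension by zero to the plane. Domination by [h x + h y] suffices because [Om] has measure one;
    it covers products [v x * v y] with [v] square integrable as well as bounded kernels. *)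
Let G := (fun z : T * T => F z.1 z.2) \_ (Om `*` Om).

Let mG : measurable_fun setT G.
Proof. by apply/(measurable_restrictT _ mOmOm). Qed.

Let GE x y : Om x -> G (x, y) = (F x \_ Om) y.
Proof.
move=> Ox; rewrite /G !patchE; suff -> : ((x, y) \in Om `*` Om) = (y \in Om) by [].
by apply/idP/idP => /set_mem; [move=> [_ ?]|move=> ?]; apply/mem_set.
Qed.

Let G0 x y : ~ Om x -> G (x, y) = 0.
Proof. by move=> Ox; rewrite /G !patchE memNset// => -[]. Qed.

Lemma dom_int_y x : Om x -> Lint Om (F x).
Proof.
move=> Ox; apply: (@int_dom _ _ _ (fun y => h x + h y)) => //; first exact: mOm.
- apply/(measurable_restrictT _ mOm).
  apply: (@eq_measurable_fun _ _ _ _ _ (fun y => G (x, y))).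
    by move=> y _; rewrite GE.
  exact: (measurableT_comp mG (pair1_measurable x)).
- apply: int_add => //; first exact: mOm.
  apply: (@int_bnd _ _ _ `|h x|) => //; first exact: mOm.
  by rewrite mu_Omega ltry.
- by move=> y Oy; exact: Fh.
Qed.

Let h0 x : Om x -> 0 <= h x.
Proof. by move=> Ox; have := le_trans (normr_ge0 _) (Fh Ox Ox); rewrite -mulr2n pmulrn_lge0. Qed.

Let Ihx x : Lint Om (fun y => h x + h y).
Proof.
apply: int_add => //; first exact: mOm.
apply: (@int_bnd _ _ _ `|h x|) => //; first exact: mOm.
by rewrite mu_Omega ltry.
Qed.

Let IG : (mu \x mu)%E.-integrable setT (EFin \o G).
Proof.
apply/integrable12ltyP; first exact/measurable_EFinP.
set H := Rintegral mu Om h.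
have IH : Lint setT ((fun x => h x + H) \_ Om).
  rewrite -restrict_EFin; apply/(integrable_mkcond _ mOm).
  apply: int_add => //; first exact: mOm.
  apply: (@int_bnd _ _ _ `|H|) => //; first exact: mOm.
  by rewrite mu_Omega ltry.
apply: (@le_lt_trans _ _ (\int[mu]_x (((fun x => h x + H) \_ Om) x)%:E)%E); last first.
  exact: integrable_lty.
apply: ge0_le_integral => //.
- by move=> x _; apply: integral_ge0.
- apply: (measurable_fun_fubini_tonelli_F (abse \o (EFin \o G))) => //=.
  by apply: measurableT_comp => //; exact/measurable_EFinP.
- by apply/measurable_EFinP; exact: int_meas IH.
move=> x _; rewrite patchE; case: ifPn => [/set_mem Ox|/negP Ox]; last first.
  rewrite (eq_integral (cst 0%E)) ?integral0// => y _.
  by rewrite /= G0 ?normr0// => Ox'; apply: Ox; exact: mem_set.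
have -> : (h x + H)%:E = (\int[mu]_(y in Om) (h x + h y)%:E)%E.
  have -> : h x + H = Rintegral mu Om (fun y => h x + h y).
    rewrite RintegralD ?RI_cst_Omega//; first exact: mOm.
    apply: (@int_bnd _ _ _ `|h x|) => //; first exact: mOm.
    by rewrite mu_Omega ltry.
  by rewrite /Rintegral fineK//; exact: (integrable_fin_num mOm (Ihx x)).
rewrite [leRHS]integral_mkcond; apply: ge0_le_integral => //.
- apply: measurableT_comp => //; apply/measurable_EFinP.
  exact: (measurableT_comp mG (pair1_measurable x)).
- apply/(measurable_restrictT _ mOm); exact: measurable_int (Ihx x).
move=> y _; rewrite /= GE// restrict_EFin/= !patchE; case: ifPn => [/set_mem Oy|_].
  by rewrite lee_fin Fh.
by rewrite /= normr0.
Qed.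

Let innerE x : (\int[mu]_y (G (x, y))%:E)%E = (((fun x => Rintegral mu Om (F x)) \_ Om) x)%:E.
Proof.
rewrite patchE; case: ifPn => [/set_mem Ox|/negP Ox]; last first.
  rewrite (eq_integral (cst 0%E)) ?integral0// => y _.
  by rewrite /= G0// => Ox'; apply: Ox; exact: mem_set.
rewrite (eq_integral (fun y => ((F x \_ Om) y)%:E)); last by move=> y _; rewrite GE.
rewrite /Rintegral fineK; last exact: (integrable_fin_num mOm (dom_int_y Ox)).
by rewrite [RHS]integral_mkcond restrict_EFin.
Qed.

Lemma dom_int_RI : Lint Om (fun x => Rintegral mu Om (F x)).
Proof.
apply/(integrable_mkcond _ mOm); rewrite restrict_EFin.
have := integrable_fubini_F IG; congr (integrable _ _ _).
by apply/funext => x; exact: innerE.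
Qed.

Lemma dom_iter : Rintegral mu Om (fun x => Rintegral mu Om (F x)) =
  fine (\int[mu]_x \int[mu]_y (G (x, y))%:E)%E.
Proof.
rewrite [LHS]Rintegral_mkcond /Rintegral; congr fine.
by apply: eq_integral => x _; rewrite innerE.
Qed.

Lemma dom_Fub : (\int[mu]_x \int[mu]_y (G (x, y))%:E = \int[mu]_y \int[mu]_x (G (x, y))%:E)%E.
Proof. exact: (Fubini IG). Qed.

End Fubini.

Lemma meas_swap (F : T -> T -> R) :
  measurable_fun (Om `*` Om) (fun z => F z.1 z.2) ->
  measurable_fun (Om `*` Om) (fun z => F z.2 z.1).
Proof.
move=> mF.
have msw : measurable_fun (Om `*` Om) (@unstable.swap T T).
  by apply: measurable_funTS; exact: measurable_swap.
apply: (measurable_comp mOmOm _ mF msw).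
by move=> _ [z [z1 z2] <-].
Qed.

Lemma fubini_dom (F : T -> T -> R) h :
  measurable_fun (Om `*` Om) (fun z => F z.1 z.2) -> Lint Om h ->
  (forall x y, Om x -> Om y -> `|F x y| <= h x + h y) ->
  Rintegral mu Om (fun x => Rintegral mu Om (fun y => F x y)) =
  Rintegral mu Om (fun y => Rintegral mu Om (fun x => F x y)).
Proof.
move=> mF Ih Fh; have mF' := meas_swap mF.
have Fh' : forall x y, Om x -> Om y -> `|F y x| <= h x + h y.
  by move=> x y Ox Oy; rewrite addrC; exact: Fh.
apply: (etrans (dom_iter mF Ih Fh)); apply: (etrans (congr1 fine (dom_Fub mF Ih Fh))).
apply: esym; apply: (etrans (dom_iter mF' Ih Fh')).
congr fine; apply: eq_integral => y _; apply: eq_integral => x _; congr EFin.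
rewrite !patchE; suff -> : ((x, y) \in Om `*` Om) = ((y, x) \in Om `*` Om) by [].
by apply/idP/idP => /set_mem [h1 h2]; apply/mem_set; split.
Qed.
End FubiniOmega.

(** * The kernel *)

Section Kernel.
Variable R : realType.
Local Notation mu := (@lebesgue_measure R).
Local Notation Lint D f := (mu.-integrable D (EFin \o f)).
Local Notation T := (measurableTypeR R).
Local Notation Om := (@Omega R : set T).
Implicit Types (D E : set T) (f g h : T -> R).

Lemma RI_subset D E f : measurable D -> measurable E -> D `<=` E -> Lint E f ->
  (forall x, E x -> 0 <= f x) -> Rintegral mu D f <= Rintegral mu E f.
Proof.
move=> mD mE DE If f0.
have e : Rintegral mu D f = Rintegral mu E (f \_ D).
  rewrite -(@RI_restr R D E) //; last by move=> x _ nD; rewrite patchE memNset.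
  by apply: RI_eq => x Dx; rewrite patchE mem_set.
have I' : Lint E (f \_ D).
  apply: (int_dom mE _ If) => [|x Ex].
    apply: (measurable_restrict f mD mE).1; apply: measurable_funS (int_meas If) => //.
  by rewrite patchE; case: ifPn => _; rewrite ?normr0 ?f0// ger0_norm// f0.
have p x : E x -> (f \_ D) x <= f x.
  by move=> Ex; rewrite patchE; case: ifPn => // _; exact: f0.
by rewrite e; exact: le_Rintegral.
Qed.

Lemma RI_refl_itv (a b : R) f : Lint `[a, b]%classic f ->
  Rintegral mu `[a, b] f = Rintegral mu `[1 - b, 1 - a] (fun y => f (1 - y)).
Proof.
move=> If.
have mI : measurable (`[a, b]%classic : set T) by exact: measurable_itv.
have If' : Lint setT (f \_ (`[a, b]%classic : set T)).
  by rewrite -restrict_EFin; apply/(integrable_mkcond _ mI).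
rewrite Rintegral_mkcond (RI_refl 1 If').2 [RHS]Rintegral_mkcond.
apply: RI_eq => y _; rewrite !patchE.
suff -> : (1 - y \in `[a, b]%classic) = (y \in `[1 - b, 1 - a]%classic) by [].
by apply/idP/idP => /set_mem /=; rewrite in_itv/= => /andP[h1 h2];
    apply/mem_set; rewrite /= in_itv/=; apply/andP; split; lra.
Qed.

Lemma mu_cc (a b : R) : a <= b -> fine (mu `[a, b]%classic) = b - a.
Proof.
rewrite le_eqVlt => /orP[/eqP ->|ab].
  by rewrite set_itv1 lebesgue_measure_set1 subrr.
by rewrite lebesgue_measure_itv/= lte_fin ab.
Qed.

Lemma mu_oo (a b : R) : a <= b -> fine (mu `]a, b[%classic) = b - a.
Proof.
move=> ab; rewrite lebesgue_measure_itv/= lte_fin; case: ltP => //= ba.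
by rewrite (@le_anti _ _ a b) ?subrr// ab ba.
Qed.

Lemma mu_fin (a b : R) : (mu `[a, b]%classic < +oo)%E.
Proof. by rewrite lebesgue_measure_itv/= lte_fin; case: ifP => // _; rewrite -EFinB ltry. Qed.

Variable w : R -> R.
Hypothesis Hw : A1 w.

Lemma w_ge0 r : 0 <= r -> 0 <= w r. Proof. by case: Hw => _ [_ [_ [_ [+ _]]]]; apply. Qed.
Lemma w_eq0 r : 1 <= r -> w r = 0. Proof. by case: Hw => _ [_ [_ [+ _]]]; apply. Qed.
Lemma w_gt0 r : 0 < r < 1 -> 0 < w r. Proof. by case: Hw => _ [_ [+ _]]; apply. Qed.
Lemma w_mono r s : 0 <= r -> r <= s -> w s <= w r.
Proof.
move=> r0 rs; have [s1|s1] := ltP s 1; first by case: Hw => _ [+ _]; apply.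
by rewrite w_eq0// w_ge0.
Qed.
Lemma w_abs_meas : measurable_fun setT (fun z : T => w `|z|).
Proof.
(* On negative arguments [w] is arbitrary; after truncation at 0 it is nonincreasing on the whole
   line, hence measurable. *)
rewrite (_ : (fun z : T => w `|z|) = (fun r => w (Num.max r 0)) \o (fun z : T => `|z|)).
  apply: measurableT_comp => //; last exact: normr_measurable.
  apply: nonincreasing_measurable => // r s rs.
  apply: w_mono; first by rewrite le_max lexx orbT.
  by rewrite ge_max !le_max lexx orbT andbT; apply/orP; left.
by apply/funext => z /=; rewrite max_l.
Qed.

Lemma w_mom : Lint setT (fun z : T => w `|z| * `|z| ^+ 2) /\
  Rintegral mu setT (fun z : T => w `|z| * `|z| ^+ 2) = 2.
Proof.
have e : (\int[mu]_(z in [set: R]) (w `|z| * `|z| ^+ 2)%:E = 2%:E)%E.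
  by case: Hw => _ [_ [_ [_ [_ +]]]].
split; last by rewrite /Rintegral e.
have mz : measurable_fun setT (fun z : T => w `|z| * `|z| ^+ 2).
  apply: measurable_funM; first exact: w_abs_meas.
  by apply: measurable_funX; exact: normr_measurable.
apply/integrableP; split; first exact/measurable_EFinP.
rewrite (eq_integral (fun z : T => (w `|z| * `|z| ^+ 2)%:E)).
  by rewrite e ltry.
by move=> z _ /=; rewrite ger0_norm// mulr_ge0 ?w_ge0.
Qed.

Section Delta.
Variable d : R.
Hypothesis d0 : 0 < d.

Lemma wd_ge0 x y : 0 <= wd w d x y.
Proof.
by rewrite /wd mulr_ge0 ?w_ge0 ?invr_ge0 ?exprn_ge0 ?divr_ge0 ?(ltW d0).
Qed.

Lemma wd_le x y r : 0 <= r -> r * d <= `|x - y| -> wd w d x y <= d ^- 3 * w r.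
Proof.
move=> r0 rd; rewrite ler_wpM2l ?invr_ge0 ?exprn_ge0 ?(ltW d0)//.
by apply: w_mono => //; rewrite ler_pdivlMr.
Qed.

Lemma wd_ge x y r : `|x - y| <= r * d -> d ^- 3 * w r <= wd w d x y.
Proof.
move=> rd; rewrite ler_wpM2l ?invr_ge0 ?exprn_ge0 ?(ltW d0)//.
by apply: w_mono; rewrite ?ler_pdivrMr ?divr_ge0 ?(ltW d0).
Qed.

Lemma wd_max x y : wd w d x y <= d ^- 3 * w 0.
Proof. by apply: wd_le; rewrite ?mul0r. Qed.

Lemma wd_eq0 x y : d <= `|x - y| -> wd w d x y = 0.
Proof. by move=> h; rewrite /wd w_eq0 ?mulr0// ler_pdivlMr// mul1r. Qed.

Lemma wd_sym x y : wd w d x y = wd w d y x.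
Proof. by rewrite /wd distrC. Qed.

Lemma wd_refl x y : wd w d (1 - x) (1 - y) = wd w d x y.
Proof. by rewrite /wd distrC; congr (_ * w (`|_| / _)); ring. Qed.

Lemma wd_meas2 : measurable_fun setT (fun z : T * T => wd w d z.1 z.2).
Proof.
rewrite /wd; apply: measurable_funM => //.
have -> : (fun z : T * T => w (`|z.1 - z.2| / d)) = (fun z : T => w `|z|) \o (fun z : T * T => (z.1 - z.2) / d).
  by apply/funext => z /=; rewrite normrM (@ger0_norm _ d^-1)// invr_ge0 ltW.
apply: (measurableT_comp w_abs_meas).
apply: measurable_funM => //.
by apply: measurable_funB; [exact: measurable_fst|exact: measurable_snd].
Qed.

Lemma wd_meas x D : measurable_fun D (fun y : T => wd w d x y).
Proof.
apply: measurable_funTS.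
exact: (measurableT_comp wd_meas2 (pair1_measurable x)).
Qed.

Lemma wd_mul_int x (p : T -> R) C : measurable_fun setT p ->
  (forall y, `|x - y| <= d -> `|p y| <= C) ->
  Lint setT (fun y => p y * wd w d x y).
Proof.
move=> mp pC; pose D : set T := `[x - d, x + d]%classic.
have mD : measurable D by exact: measurable_itv.
have DE y : D y <-> `|x - y| <= d.
  by rewrite /D/= in_itv/= ler_distlC; split => /andP[h1 h2]; apply/andP; split; lra.
apply/(@int_restr R D setT) => //.
  move=> y _ nD; rewrite wd_eq0 ?mulr0//; apply: ltW; rewrite ltNge; apply/negP => h.
  by apply: nD; apply/DE.
apply: (@int_bnd _ _ _ (C * (d ^- 3 * w 0))) => //.
- exact: mu_fin.
- by apply: measurable_funM; [exact: measurable_funTS|exact: wd_meas].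
- move=> y /DE h; rewrite normrM (@ger0_norm _ (wd _ _ _ _)) ?wd_ge0//.
  by apply: ler_pM; rewrite ?wd_ge0 ?wd_max ?pC.
Qed.

Lemma wd_int x : Lint setT (fun y => wd w d x y).
Proof.
by apply: (@eq_int R _ (fun y => 1 * wd w d x y)) => // [y _|];
  [rewrite mul1r|apply: (@wd_mul_int x (cst 1) 1) => // y _; rewrite normr1].
Qed.

(** The substitution [z = (y - x) / d] reduces this to the normalisation of [w]; the factor [d^-3]
    in [wd] is what makes the value independent of [d]. *)
Lemma wd_mom2 x : Lint setT (fun y => (y - x) ^+ 2 * wd w d x y) /\
  Rintegral mu setT (fun y => (y - x) ^+ 2 * wd w d x y) = 2.
Proof.
have [Im em] := w_mom; have c0 : 0 < d^-1 by rewrite invr_gt0.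
have [I1 e1] := RI_scale (- x / d) c0 Im.
have E (y : T) : d^-1 * (w `|d^-1 * y + - x / d| * `|d^-1 * y + - x / d| ^+ 2) =
    (y - x) ^+ 2 * wd w d x y.
  have -> : d^-1 * y + - x / d = (y - x) / d by ring.
  rewrite real_normK ?num_real// normrM (@ger0_norm _ d^-1) ?(ltW c0)//.
  by rewrite /wd distrC; field; rewrite gt_eqF.
split; first by apply: (@eq_int R _ _ _ _ (fun y _ => E y)) => //; exact: int_scale.
by rewrite -(RI_eq (fun y _ => E y)) RintegralZl// -e1 em.
Qed.

Lemma wd_mom1_int x : Lint setT (fun y => (y - x) * wd w d x y).
Proof.
apply: (@wd_mul_int x (fun y => y - x) d) => [|y h]; last by rewrite distrC.
exact: measurable_funB.
Qed.

(** The reflection [y -> 2 x - y] changes the sign of the integrand. *)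
Lemma wd_mom1 x : Rintegral mu setT (fun y => (y - x) * wd w d x y) = 0.
Proof.
have I1 := wd_mom1_int x.
have [_ e] := RI_refl (x + x) I1.
have : Rintegral mu setT (fun y : T => (x + x - y - x) * wd w d x (x + x - y)) =
       -1 * Rintegral mu setT (fun y => (y - x) * wd w d x y).
  rewrite -RintegralZl//; apply: RI_eq => y _.
  rewrite mulrA; congr (_ * _); first by ring.
  by rewrite /wd distrC; congr (_ * w (`|_| / _)); ring.
by rewrite -e; lra.
Qed.

End Delta.

End Kernel.

(** * The boundary correction [bd]: bounds and measurability *)

Section Layer.
Variable R : realType.
Local Notation mu := (@lebesgue_measure R).
Local Notation Lint D f := (mu.-integrable D (EFin \o f)).
Local Notation T := (measurableTypeR R).
Local Notation Om := (@Omega R : set T).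
Implicit Types (D E : set T) (f g h : T -> R).
Variable w : R -> R.
Hypothesis Hw : A1 w.
Variable d : R.
Hypotheses (d0 : 0 < d) (d1 : d < 2^-1).

Lemma dw_ge0 r : 0 <= r -> 0 <= d ^- 3 * w r.
Proof.
by move=> r0; apply: mulr_ge0; [rewrite invr_ge0 exprn_ge0// ltW|exact: w_ge0].
Qed.

(* Vanishes for [d <= x], so that one formula describes [bd] on both layers
   and in between; see [bdE]. *)
Definition Ph (x : R) : R := Rintegral mu `[-1, 0] (fun y => (x - y) * wd w d x y).

Lemma wd_lin_int x : Lint setT (fun y => (x - y) * wd w d x y).
Proof. by apply: (@wd_mul_int R w Hw d d0 x (fun y => x - y) d) => //; exact: measurable_funB. Qed.

Lemma wd_lin_intS x (D : set T) : measurable D -> Lint D (fun y => (x - y) * wd w d x y).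
Proof. by move=> mD; apply: integrableS (wd_lin_int x). Qed.

Lemma Ph0 x : d <= x -> Ph x = 0.
Proof.
have := d0 => d0'; move=> dx; rewrite /Ph (@RI_eq R _ _ (cst 0)); first by rewrite Rintegral_cst ?mul0r//; exact: measurable_itv.
move=> y /=; rewrite in_itv/= => /andP[y1 y2]; rewrite wd_eq0 ?mulr0//.
by rewrite ger0_norm; lra.
Qed.

Lemma PhL x : 0 < x < d -> Ph x = Rintegral mu `[x - d, 0] (fun y => (x - y) * wd w d x y).
Proof.
move=> /andP[x0 xd]; have := d1 => d1'; apply/esym/RI_restr.
  by move=> y /=; rewrite !in_itv/= => /andP[y1 y2]; apply/andP; split; lra.
move=> y /=; rewrite !in_itv/= => /andP[y1 y2] /negP; rewrite y2 andbT -ltNge => h.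
by rewrite wd_eq0 ?mulr0// ger0_norm; lra.
Qed.

(** For [d < 1/2] the layers are disjoint, so at most one summand is nonzero; the reflection
    [y -> 1 - y] maps the integral of the right layer to [Ph (1 - x)]. *)
Lemma bdE x : Om x -> bd w d x =
  2 / (x + d) ^+ 2 * Ph x + 2 / (1 - x + d) ^+ 2 * Ph (1 - x).
Proof.
have := d1 => d1'; rewrite /Om /= in_itv/= => /andP[x0 x1]; rewrite /bd.
have [xd|dx] := ltP x d.
  by rewrite x0/= PhL ?x0// (@Ph0 (1 - x)) ?mulr0 ?addr0//; lra.
rewrite andbF (@Ph0 x)// mulr0 add0r x1 andbT.
have [xd|xd] := ltP (1 - d) x; last by rewrite Ph0 ?mulr0//; lra.
congr (_ * _); rewrite PhL; last by apply/andP; split; lra.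
have E (y : R) : (y - x) * wd w d x y = - ((x - y) * wd w d x y) by ring.
rewrite RI_refl_itv.
  have -> : 1 - (x + d) = 1 - x - d by ring.
  rewrite subrr; apply: RI_eq => y _; congr (_ * _); first by ring.
  by rewrite -[in RHS](@wd_refl R w d) /wd; congr (_ * w (`|_| / _)); ring.
apply: (@eq_int R _ (fun y => -1 * ((x - y) * wd w d x y))).
- exact: measurable_itv.
- by move=> y _; ring.
- by apply: int_scale; [exact: measurable_itv|apply: wd_lin_intS; exact: measurable_itv].
Qed.

Lemma bd_refl x : Om x -> bd w d (1 - x) = bd w d x.
Proof.
move=> Ox; have Ox' : Om (1 - x).
  by move: Ox; rewrite /Om /= !in_itv/= => /andP[h1 h2]; apply/andP; split; lra.
by rewrite !bdE// subKr addrC.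
Qed.

Lemma bd_mid x : Om x -> d <= x -> x <= 1 - d -> bd w d x = 0.
Proof. by move=> Ox dx xd; rewrite bdE// !Ph0 ?mulr0 ?addr0//; lra. Qed.

Lemma bd_left x : 0 < x < d -> bd w d x = 2 / (x + d) ^+ 2 * Ph x.
Proof.
have := d1 => d1' /andP[x0 xd]; rewrite bdE.
  by rewrite (@Ph0 (1 - x)) ?mulr0 ?addr0//; lra.
by rewrite /Om /= in_itv/=; apply/andP; split; lra.
Qed.

Lemma Ph_ge0 x : 0 < x -> 0 <= Ph x.
Proof.
move=> x0; apply: Rintegral_ge0 => y /=; rewrite in_itv/= => /andP[_ y2].
by apply: mulr_ge0; [lra|exact: wd_ge0].
Qed.

Lemma bd_ge0 x : Om x -> 0 <= bd w d x.
Proof.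
have := d0 => d0'; move=> Ox; rewrite bdE//.
move: Ox; rewrite /Om /= in_itv/= => /andP[x0 x1].
by apply: addr_ge0; apply: mulr_ge0; rewrite ?Ph_ge0 ?subr_gt0//;
  apply: divr_ge0 => //; apply: exprn_ge0; lra.
Qed.

(** On [[x - d, 0]], of length [d - x], the distance [x - y] lies between [r * d] and [d]. The
    factor [d - x] is kept because it makes [bd] small near the inner edge of the layer. *)
Lemma Ph_le x r : 0 < x < d -> 0 <= r -> r * d <= x ->
  Ph x <= d * (d ^- 3 * w r) * (d - x).
Proof.
move=> /andP[x0 xd] r0 rx; rewrite PhL ?x0//.
have mI : measurable (`[x - d, 0]%classic : set T) by exact: measurable_itv.
have -> : d * (d ^- 3 * w r) * (d - x) = Rintegral mu `[x - d, 0] (cst (d * (d ^- 3 * w r))).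
  by rewrite Rintegral_cst// mu_cc//; lra.
apply: le_Rintegral => //.
- exact: wd_lin_intS.
- by apply: (@int_bnd _ _ _ `|d * (d ^- 3 * w r)|) => //; exact: mu_fin.
- move=> y /=; rewrite in_itv/= => /andP[y1 y2].
  have y0 : 0 <= x - y by lra.
  apply: ler_pM => //; [exact: wd_ge0|lra|].
  by apply: wd_le => //; rewrite ger0_norm//; lra.
Qed.

Lemma Ph_ge x : 0 < x < 7 / 8 * d ->
  7 / 8 * d * (d ^- 3 * w (15 / 16)) * (d / 16) <= Ph x.
Proof.
move=> /andP[x0 xd]; have := d0 => d0'; rewrite PhL; last by apply/andP; split; lra.
(* On [J] the distance [x - y] runs through [[7/8 d, 15/16 d]]. The bound [x < 7/8 d] keeps [J] to
   the left of 0, and [15/16 < 1] keeps [w] positive there. *)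
pose J : set T := `[x - 15 / 16 * d, x - 7 / 8 * d]%classic.
have mJ : measurable J by exact: measurable_itv.
have mI : measurable (`[x - d, 0]%classic : set T) by exact: measurable_itv.
apply: (@le_trans _ _ (Rintegral mu J (fun y => (x - y) * wd w d x y))); last first.
  apply: RI_subset => //.
  - by move=> y; rewrite /J /= !in_itv/= => /andP[y1 y2]; apply/andP; split; lra.
  - exact: wd_lin_intS.
  - move=> y /=; rewrite in_itv/= => /andP[_ y2].
    by apply: mulr_ge0; [lra|exact: wd_ge0].
have -> : 7 / 8 * d * (d ^- 3 * w (15 / 16)) * (d / 16) =
    Rintegral mu J (cst (7 / 8 * d * (d ^- 3 * w (15 / 16)))).
  rewrite Rintegral_cst// mu_cc//; last lra.
  by congr (_ * _); field.
apply: le_Rintegral => //.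
- by apply: (@int_bnd _ _ _ `|7 / 8 * d * (d ^- 3 * w (15 / 16))|) => //; exact: mu_fin.
- exact: wd_lin_intS.
- move=> y; rewrite /J /= in_itv/= => /andP[y1 y2].
  apply: ler_pM; [lra| |lra|].
    by apply: dw_ge0.
  by apply: wd_ge => //; rewrite ger0_norm; lra.
Qed.

Lemma bd_le_left x r : 0 < x < d -> 0 <= r -> r * d <= x ->
  bd w d x <= 2 * (d - x) / d * (d ^- 3 * w r).
Proof.
move=> xx r0 rx; rewrite bd_left//; have /andP[x0 xd] := xx.
have q0 : 0 <= d ^- 3 * w r by exact: dw_ge0.
apply: (@le_trans _ _ (2 / d ^+ 2 * (d * (d ^- 3 * w r) * (d - x)))); last first.
  by rewrite le_eqVlt; apply/orP; left; apply/eqP; field; rewrite gt_eqF.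
apply: ler_pM; rewrite ?Ph_ge0 ?Ph_le//.
  by apply: divr_ge0 => //; apply: exprn_ge0; rewrite addr_ge0 ?(ltW x0) ?(ltW d0).
rewrite ler_pM2l// lef_pV2 ?posrE ?exprn_gt0 ?addr_gt0//.
by rewrite ler_pXn2r ?nnegrE ?addr_ge0 ?(ltW x0) ?(ltW d0)// lerDr ltW.
Qed.

Lemma bd_ge_left x : 0 < x < 7 / 8 * d ->
  7 / 256 * w (15 / 16) * d ^- 3 <= bd w d x.
Proof.
move=> xx; have /andP[x0 xd] := xx; have := d0 => d0'.
rewrite bd_left; last by apply/andP; split; lra.
have q0 : 0 <= d ^- 3 * w (15 / 16) by apply: dw_ge0.
(* The constant [7 / 256] arises from [x + d <= 2 * d] in the prefactor of [bd] together with
   [Ph_ge]. *)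
apply: (@le_trans _ _ (2 / (2 * d) ^+ 2 * (7 / 8 * d * (d ^- 3 * w (15 / 16)) * (d / 16)))).
  by rewrite le_eqVlt; apply/orP; left; apply/eqP; field; rewrite gt_eqF.
apply: ler_pM; rewrite ?Ph_ge//.
- by apply: divr_ge0 => //; apply: exprn_ge0; lra.
- by apply: mulr_ge0; [apply: mulr_ge0 => //; lra|lra].
rewrite ler_pM2l// lef_pV2 ?posrE ?exprn_gt0 ?addr_gt0//; last lra.
by rewrite ler_pXn2r ?nnegrE//; lra.
Qed.

Lemma bd_max x : Om x -> bd w d x <= 2 * (d ^- 3 * w 0).
Proof.
have q0 : 0 <= d ^- 3 * w 0 by exact: dw_ge0.
have := d0 => d0'; have := d1 => d1'.
have L z : 0 < z < d -> bd w d z <= 2 * (d ^- 3 * w 0).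
  move=> zz; have /andP[z0 zd] := zz; apply: le_trans (bd_le_left zz (lexx 0) _) _.
    by rewrite mul0r ltW.
  apply: ler_wpM2r => //; rewrite ler_pdivrMr//; lra.
move=> Ox; have := Ox; rewrite /Om /= in_itv/= => /andP[x0 x1].
have [xd|dx] := ltP x d; first by apply: L; rewrite x0.
have [xd|xd] := ltP (1 - d) x; last by rewrite bd_mid// mulr_ge0.
by rewrite -bd_refl//; apply: L; apply/andP; split; lra.
Qed.

Lemma Ph_meas : measurable_fun Om Ph.
Proof.
(* The absolute value agrees with [x - y] for [x > 0 >= y] and makes the integrand nonnegative
   everywhere, so that Tonelli's theorem gives measurability. *)
pose f (z : T * T) := (`|z.1 - z.2| * wd w d z.1 z.2) * \1_(`[-1, 0]%classic : set T) z.2.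
have f0 z : 0 <= f z by rewrite mulr_ge0// mulr_ge0// wd_ge0.
have mf : measurable_fun setT f.
  apply: measurable_funM; last first.
    apply: (measurableT_comp _ measurable_snd).
    by apply: measurable_indic; exact: measurable_itv.
  apply: measurable_funM; last exact: wd_meas2.
  apply: measurableT_comp => //.
  by apply: measurable_funB; [exact: measurable_fst|exact: measurable_snd].
have := @measurable_fun_fubini_tonelli_F _ _ _ _ R mu (EFin \o f) _ _.
move=> /(_ ltac:(by apply/measurable_EFinP)) /(_ ltac:(by move=> z; rewrite lee_fin)) mF.
apply: (@eq_measurable_fun _ _ _ _ _ (fine \o (fun x : T => \int[mu]_y (f (x, y))%:E)%E)).
  move=> x /set_mem Ox /=; rewrite /Ph /Rintegral [in RHS]integral_mkcond; congr fine.
  apply: eq_integral => y _; rewrite patchE/= /f/= indicE.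
  case: ifPn => [/set_mem yI|_]; last by rewrite mulr0.
  move: yI Ox; rewrite /Om /= !in_itv/= => /andP[y1 y2] /andP[x0 x1].
  by rewrite mulr1 ger0_norm//; lra.
by apply: measurableT_comp => //; exact: measurable_funTS.
Qed.

Lemma Om_refl (x : R) : Om x -> Om (1 - x).
Proof. by rewrite /Om /= !in_itv/= => /andP[h1 h2]; apply/andP; split; lra. Qed.

Lemma bd_meas : measurable_fun Om (bd w d).
Proof.
have := d0 => d0'.
(* Truncation at 0 changes nothing on [Om] and makes the prefactor monotone on the whole line, hence
   measurable. *)
pose V (x : R) := 2 / (Num.max x 0 + d) ^+ 2.
have mV : measurable_fun setT V.
  apply: nonincreasing_measurable => // r s rs.
  have p (z : R) : 0 < Num.max z 0 + d by rewrite ltr_wpDl// le_max lexx orbT.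
  rewrite ler_pM2l// lef_pV2 ?posrE ?exprn_gt0// ler_pXn2r ?nnegrE ?(ltW (p _))// lerD2r.
  by rewrite ge_max !le_max lexx orbT andbT; apply/orP; left.
have mr : measurable_fun Om (fun x : T => 1 - x) by exact: measurable_funB.
apply: (@eq_measurable_fun _ _ _ _ _ (fun x : T => V x * Ph x + V (1 - x) * Ph (1 - x))).
  move=> x /set_mem Ox; rewrite bdE// /V !max_l//; move: Ox;
    by rewrite /Om /= in_itv/= => /andP[h1 h2]; lra.
have mP' : measurable_fun Om (fun x => Ph (1 - x)).
  by apply: (measurable_comp (@mOm R) _ Ph_meas mr) => _ [x Ox <-]; exact: Om_refl.
apply: measurable_funD; apply: measurable_funM => //.
- exact: measurable_funTS.
- exact: Ph_meas.
- exact: (measurableT_comp mV mr).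
Qed.
End Layer.

(** * Row and column sums of the corrected kernel *)

Section Rows.
Variable R : realType.
Local Notation mu := (@lebesgue_measure R).
Local Notation Lint D f := (mu.-integrable D (EFin \o f)).
Local Notation T := (measurableTypeR R).
Local Notation Om := (@Omega R : set T).

Section Ind.
Context (dX : measure_display) (X : measurableType dX).
Implicit Types (D : set X) (p q : X -> R).

Lemma meas_natb D (b : X -> bool) : measurable_fun D b ->
  measurable_fun D (fun x => (b x)%R%:R : R).
Proof.
move=> mb; apply: (measurableT_comp (f := fun c : bool => c%:R : R) _ mb).
by [].
Qed.

Lemma meas_le_ind D p q : measurable_fun D p -> measurable_fun D q ->
  measurable_fun D (fun x => (p x <= q x)%R%:R : R).
Proof. by move=> mp mq; apply: meas_natb; exact: measurable_fun_ler. Qed.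

Lemma meas_lt_ind D p q : measurable_fun D p -> measurable_fun D q ->
  measurable_fun D (fun x => (p x < q x)%R%:R : R).
Proof. by move=> mp mq; apply: meas_natb; exact: measurable_fun_ltr. Qed.

Lemma meas_and_ind D (b c : X -> bool) : measurable_fun D (fun x => (b x)%R%:R : R) ->
  measurable_fun D (fun x => (c x)%R%:R : R) ->
  measurable_fun D (fun x => (b x && c x)%R%:R : R).
Proof.
move=> mb mc; rewrite (_ : (fun x => (b x && c x)%R%:R) = (fun x => (b x)%R%:R * (c x)%R%:R)).
  exact: measurable_funM.
by apply/funext => x; rewrite -natrM mulnb.
Qed.
End Ind.

Implicit Types (D E : set T) (f g h : T -> R).

Lemma int_Om f C : measurable_fun Om f -> (forall x, Om x -> `|f x| <= C) -> Lint Om f.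
Proof. by move=> mf fC; apply: (@int_bnd _ _ _ C) => //; [exact: mOm|rewrite mu_Omega ltry]. Qed.

Lemma natb_le1 (b : bool) : `|b%:R : R| <= 1.
Proof. by case: b; rewrite ?normr1 ?normr0. Qed.

Lemma int_natb (b : T -> bool) : measurable_fun Om (fun y => (b y)%R%:R : R) ->
  Lint Om (fun y => (b y)%R%:R).
Proof. by move=> mb; apply: (@int_Om _ 1) => // x _; exact: natb_le1. Qed.

Lemma mset_le f : measurable_fun Om f -> measurable ([set y | Om y /\ 0 <= f y] : set T).
Proof.
move=> mf; have := mf (@mOm R) `[0, +oo[%classic (measurable_itv _).
congr measurable; apply/seteqP; split => y /=; rewrite in_itv/= andbT.
  by [].
by [].
Qed.

Lemma fin_Om (D : set T) : measurable D -> D `<=` Om -> mu D \is a fin_num.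
Proof.
move=> mD DO; rewrite ge0_fin_numE//; apply: (@le_lt_trans _ _ (mu Om)).
  by apply: le_measure; rewrite ?inE//; exact: mOm.
by rewrite mu_Omega ltry.
Qed.

Lemma itv_ind_meas (a b : R) (D : set T) :
  measurable_fun D (fun y : T => (a <= y <= b)%R%:R : R).
Proof. by apply: meas_and_ind; apply: meas_le_ind. Qed.

Lemma itvo_ind_meas (a b : R) (D : set T) :
  measurable_fun D (fun y : T => (a < y < b)%R%:R : R).
Proof. by apply: meas_and_ind; apply: meas_lt_ind. Qed.

Lemma RI_itv_le (a b : R) : a <= b ->
  Rintegral mu Om (fun y => (a <= y <= b)%R%:R) <= b - a.
Proof.
move=> ab; have mI : measurable (`[a, b]%classic : set T) by exact: measurable_itv.
have e : [set y | Om y /\ (a <= y <= b)] = Om `&` `[a, b]%classic.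
  by apply/seteqP; split => y /=; rewrite in_itv.
have mOI := measurableI _ _ (@mOm R) mI.
rewrite RI_ind ?e//; last exact: mOm.
rewrite -mu_cc//; apply: fine_le.
- by apply: fin_Om => // y [].
- by rewrite ge0_fin_numE//; exact: mu_fin.
- by apply: le_measure; rewrite ?inE// => y [].
Qed.

Lemma RI_itvo (a b : R) : 0 <= a -> a <= b -> b <= 1 ->
  Rintegral mu Om (fun y => (a < y < b)%R%:R) = b - a.
Proof.
move=> a0 ab b1.
have e : [set y | Om y /\ (a < y < b)] = `]a, b[%classic.
  apply/seteqP; split => y /=; rewrite !in_itv/=; first by case.
  move=> /andP[h1 h2]; rewrite h1 h2; split => //.
  by rewrite /Omega /= in_itv/=; apply/andP; split; lra.
rewrite RI_ind ?e; [exact: mu_oo|exact: mOm|exact: measurable_itv].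
Qed.

Lemma RI_itvo_le (a b : R) : a <= b ->
  Rintegral mu Om (fun y => (a < y < b)%R%:R) <= b - a.
Proof.
move=> ab; apply: le_trans (RI_itv_le ab); apply: le_Rintegral.
- exact: mOm.
- by apply: int_natb; exact: itvo_ind_meas.
- by apply: int_natb; exact: itv_ind_meas.
- by move=> y _; rewrite ler_nat; case: andP => // -[h1 h2]; rewrite !ltW.
Qed.

Lemma ae_neq (a : T) : {ae mu, forall y, y <> a}.
Proof.
exists [set a]; split; [exact: measurable_set1|exact: lebesgue_measure_set1|].
by move=> y /= /contrapT.
Qed.

Variable w : R -> R.
Hypothesis Hw : A1 w.
Variable d : R.
Hypotheses (d0 : 0 < d) (d1 : d < 2^-1).

Definition Bi (x y : R) : bool := `|y - x| <= d.

Lemma KdE x y : Kd w d x y = wd w d x y - bd w d x * (Bi x y)%R%:R.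
Proof. by rewrite /Kd /Bi; case: ifP. Qed.

Lemma Kd_refl x y : Om x -> Kd w d (1 - x) (1 - y) = Kd w d x y.
Proof.
move=> Ox; rewrite !KdE wd_refl bd_refl// /Bi; congr (_ - _ * (_ <= _)%R%:R).
by rewrite distrC; congr (`|_|); ring.
Qed.

Lemma dist_meas2 (D : set (T * T)) : measurable_fun D (fun z => `|z.2 - z.1|).
Proof.
apply: measurable_funTS; apply: measurableT_comp => //.
by apply: measurable_funB; [exact: measurable_snd|exact: measurable_fst].
Qed.

Lemma Kd_meas2 : measurable_fun (Om `*` Om) (fun z : T * T => Kd w d z.1 z.2).
Proof.
rewrite (_ : (fun z : T * T => _) =
  (fun z => wd w d z.1 z.2 - bd w d z.1 * (Bi z.1 z.2)%R%:R)); last first.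
  by apply/funext => z; rewrite KdE.
apply: measurable_funB; first by apply: measurable_funTS; exact: wd_meas2.
apply: measurable_funM; first by apply: meas_fst; exact: bd_meas.
by apply: meas_le_ind => //; exact: dist_meas2.
Qed.

Lemma dist_meas x D : measurable_fun D (fun y : T => `|y - x|).
Proof. by apply: measurableT_comp => //; exact: measurable_funB. Qed.

Lemma Bi_meas x D : measurable_fun D (fun y : T => (Bi x y)%R%:R : R).
Proof. by apply: meas_le_ind => //; exact: dist_meas. Qed.

Lemma Kd_meas x : measurable_fun Om (Kd w d x).
Proof.
rewrite (_ : Kd w d x = (fun y => wd w d x y - bd w d x * (Bi x y)%R%:R)); last first.
  by apply/funext => z; rewrite KdE.
apply: measurable_funB; first exact: wd_meas.
by apply: measurable_funM => //; exact: Bi_meas.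
Qed.

Lemma Kd_max x y : Om x -> `|Kd w d x y| <= 3 * (d ^- 3 * w 0).
Proof.
move=> Ox; rewrite KdE; apply: le_trans (ler_normB _ _) _.
have -> : 3 * (d ^- 3 * w 0) = d ^- 3 * w 0 + 2 * (d ^- 3 * w 0) * 1 by ring.
rewrite [X in _ + X]normrM !ger0_norm ?bd_ge0 ?wd_ge0//.
by apply: lerD; [exact: wd_max|apply: ler_pM; rewrite ?bd_ge0 ?bd_max//; case: (Bi x y)].
Qed.

Lemma Kd_int x : Om x -> Lint Om (Kd w d x).
Proof. by move=> Ox; apply: int_Om => [|y _]; [exact: Kd_meas|exact: Kd_max]. Qed.

Lemma wd_intO x : Lint Om (wd w d x).
Proof. by apply: integrableS (wd_int Hw d0 x) => //; exact: mOm. Qed.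

Lemma ad_refl x : ad w d (1 - x) = ad w d x.
Proof.
rewrite /ad (RI_refl_Omega (wd_intO _)).2; apply: RI_eq => y _; exact: wd_refl.
Qed.

Lemma ring_mass x : Rintegral mu Om (fun y => (15 / 16 * d <= `|y - x| <= d)%R%:R) <= d / 8.
Proof.
have := d0 => d0'.
pose p (y : R) := (x - d <= y <= x - 15 / 16 * d)%R%:R : R.
pose q (y : R) := (x + 15 / 16 * d <= y <= x + d)%R%:R : R.
have Ip : Lint Om p by apply: int_natb; exact: itv_ind_meas.
have Iq : Lint Om q by apply: int_natb; exact: itv_ind_meas.
apply: (@le_trans _ _ (Rintegral mu Om (fun y => p y + q y))); last first.
  rewrite RintegralD//; last exact: mOm.
  have h1 : Rintegral mu Om p <= d / 16.
    by apply: le_trans (RI_itv_le _) _; lra.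
  have h2 : Rintegral mu Om q <= d / 16.
    by apply: le_trans (RI_itv_le _) _; lra.
  by apply: le_trans (lerD h1 h2) _; lra.
apply: le_Rintegral; first exact: mOm.
- apply: int_natb; apply: meas_and_ind; apply: meas_le_ind => //; exact: dist_meas.
- by apply: int_add => //; exact: mOm.
move=> y _; rewrite /p /q; case: (boolP (_ <= `|y - x| <= d)) => [/andP[h1 h2]|_]; last first.
  by rewrite addr_ge0.
have [yx|xy] := leP y x.
  have -> : (x - d <= y <= x - 15 / 16 * d) by apply/andP; move: h1 h2; rewrite ler0_norm; [split; lra|lra].
  by rewrite lerDl.
have -> : (x + 15 / 16 * d <= y <= x + d) by apply/andP; move: h1 h2; rewrite ger0_norm; [split; lra|lra].
by rewrite lerDr.
Qed.

Hypothesis H2 : A2s w d.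

(** This is how A2s enters. The absolute value of [Kd] is [Kd] plus twice its negative part; the
    integral of [Kd] is [ad] minus [bd] times the mass of the window, and the negative part is at
    most [bd] on at most half of the window, so the correction terms cancel in the row sum. *)
Lemma neg_mass x : Om x ->
  2 * Rintegral mu Om (fun y => (Kd w d x y < 0)%R%:R) <= Rintegral mu Om (fun y => (Bi x y)%R%:R).
Proof.
move=> Ox; have mK := Kd_meas x; have mO := @mOm R.
have mle : measurable_fun Om (fun y : T => (0 <= Kd w d x y)%R%:R : R) by apply: meas_le_ind.
have mge : measurable_fun Om (fun y : T => (Kd w d x y <= 0)%R%:R : R) by apply: meas_le_ind.
have mlt : measurable_fun Om (fun y : T => (Kd w d x y < 0)%R%:R : R) by apply: meas_lt_ind.
have Ile := int_natb mle; have Ige := int_natb mge; have Ilt := int_natb mlt.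
have IB := int_natb (@Bi_meas x Om).
have mn : measurable ([set y | Om y /\ Kd w d x y <= 0] : set T).
  have := mset_le (measurable_funN mK); congr measurable.
  by apply/seteqP; split => y /= [? ?]; split => //; rewrite ?oppr_ge0// -oppr_ge0.
have A : Rintegral mu Om (fun y => (Kd w d x y <= 0)%R%:R) <=
         Rintegral mu Om (fun y => (0 <= Kd w d x y)%R%:R).
  rewrite !RI_ind//; last exact: mset_le.
  apply: fine_le; last exact: H2.
  - by apply: fin_Om => // y [].
  - by apply: fin_Om => [|y []//]; exact: mset_le.
have : Rintegral mu Om (fun y => 2 * (Kd w d x y < 0)%R%:R) <=
   Rintegral mu Om (fun y => (Bi x y)%R%:R - (0 <= Kd w d x y)%R%:R + (Kd w d x y <= 0)%R%:R).
  have I1 := int_sub mO IB Ile.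
  apply: le_Rintegral => //; first exact: int_scale; first exact: int_add.
  (* Outside the window [Kd] vanishes, so a nonzero value forces [Bi x y]; the zeros of [Kd] are
     counted by both sets in A2s and cancel. *)
  move=> y _; have [e|e|e] := ltgtP (Kd w d x y) 0.
  - suff -> : Bi x y by rewrite /=; lra.
    apply: contraLR e => /negbTE nB; rewrite -leNgt KdE nB mulr0 subr0.
    exact: wd_ge0.
  - suff -> : Bi x y by rewrite /=; lra.
    apply: contraLR e => nB; rewrite -leNgt KdE (negbTE nB) mulr0 subr0.
    rewrite wd_eq0// distrC ltW// ltNge; exact: nB.
  - by rewrite /=; case: (Bi x y) => /=; lra.
rewrite RintegralZl// RintegralD// ?RintegralB//; last exact: int_sub.
by lra.
Qed.

(* Where [Kd < 0], its negative part is at most [bd - m d^-3], except on the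
   ring [15/16 d <= |y - x| <= d] of measure at most [d / 8]. *)
Lemma row_slack x m : Om x -> 0 <= m -> m <= w (15 / 16) -> m * d ^- 3 <= bd w d x ->
  Rintegral mu Om (fun y => `|Kd w d x y|) <=
  ad w d x - m * d ^- 3 * (Rintegral mu Om (fun y => (Bi x y)%R%:R) - d / 4).
Proof.
move=> Ox m0 mw mb; set M := m * d ^- 3; set b := bd w d x.
have mO := @mOm R; have mK := Kd_meas x; have IK := Kd_int Ox.
have M0 : 0 <= M by apply: mulr_ge0 => //; rewrite invr_ge0 exprn_ge0// ltW.
pose S (y : R) := (15 / 16 * d <= `|y - x| <= d)%R%:R : R.
pose N (y : R) := (Kd w d x y < 0)%R%:R : R.
have IB := int_natb (@Bi_meas x Om).
have IN : Lint Om N by apply: int_natb; apply: meas_lt_ind.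
have IS : Lint Om S.
  by apply: int_natb; apply: meas_and_ind; apply: meas_le_ind => //; exact: dist_meas.
have I1 : Lint Om (fun y => b * (Bi x y)%R%:R) by exact: int_scale.
have I2 : Lint Om (fun y => 2 * (b - M) * N y) by exact: int_scale.
have I3 : Lint Om (fun y => 2 * M * S y) by exact: int_scale.
have I4 := int_sub mO (wd_intO x) I1.
have I5 := int_add mO I4 I2.
have : Rintegral mu Om (fun y => `|Kd w d x y|) <= Rintegral mu Om
    (fun y => wd w d x y - b * (Bi x y)%R%:R + 2 * (b - M) * N y + 2 * M * S y).
  apply: le_Rintegral => //; first exact: int_abs; first exact: int_add.
  move=> y _; have S0 : 0 <= 2 * M * S y by rewrite mulr_ge0// mulr_ge0.
  rewrite -[X in _ <= X + _ + _]KdE /N; have [K0|K0] := ltP (Kd w d x y) 0; last first.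
    by rewrite ger0_norm// mulr0 addr0 lerDl.
  rewrite ltr0_norm//= mulr1.
  have By : Bi x y.
    apply: contraLR K0 => /negbTE nB; rewrite -leNgt KdE nB mulr0 subr0; exact: wd_ge0.
  move: S0 K0; rewrite KdE By mulr1 -/b /S; have w0 := wd_ge0 Hw d0 x y.
  have [h|h] := leP (15 / 16 * d) `|y - x|; first by move: By; rewrite /Bi => -> /=; lra.
  move=> /= _ _; rewrite mulr0 addr0.
  have : M <= wd w d x y.
    apply: (@le_trans _ _ (d ^- 3 * w (15 / 16))).
      by rewrite /M mulrC ler_wpM2l// invr_ge0 exprn_ge0// ltW.
    by apply: wd_ge => //; rewrite distrC ltW.
  lra.
rewrite RintegralD// RintegralD// RintegralB//; last exact: wd_intO.
rewrite (RintegralZl b mO IB) (RintegralZl (2 * (b - M)) mO IN) (RintegralZl (2 * M) mO IS).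
rewrite (_ : Rintegral mu Om (fun y => wd w d x y) = ad w d x)//.
have := neg_mass Ox; have := ring_mass x; rewrite -/S -/N => h1 h2.
have h3 := ler_wpM2l M0 h1.
have bM : 0 <= b - M by rewrite subr_ge0.
have h4 := ler_wpM2l bM h2.
set rB := Rintegral mu Om (fun y => (Bi x y)%R%:R) in h2 h4 *.
set rN := Rintegral mu Om N in h2 h4 *; set rS := Rintegral mu Om S in h1 h3 *.
move=> h5; apply: (le_trans h5). lra.
Qed.

Lemma row_le x : Om x -> Rintegral mu Om (fun y => `|Kd w d x y|) <= ad w d x.
Proof.
move=> Ox; have := @row_slack x 0 Ox (lexx 0); rewrite !mul0r subr0; apply.
  by apply: w_ge0.
exact: bd_ge0.
Qed.

Lemma row_layer x : 0 < x < 7 / 8 * d ->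
  Rintegral mu Om (fun y => `|Kd w d x y|) <=
  ad w d x - 7 / 256 * w (15 / 16) * d ^- 3 * (3 / 4 * d).
Proof.
move=> xx; have /andP[x0 xd] := xx; have := d0 => d0'; have := d1 => d1'.
have Ox : Om x by rewrite /Om /= in_itv/=; apply/andP; split; lra.
have w0 : 0 <= w (15 / 16) by apply: w_ge0.
have := @row_slack x (7 / 256 * w (15 / 16)) Ox.
move=> /(_ ltac:(by apply: mulr_ge0)) /(_ ltac:(lra)) /(_ (bd_ge_left Hw d0 d1 xx)) h.
apply: (le_trans h); rewrite lerD2l lerN2.
apply: ler_wpM2l.
  by apply: mulr_ge0; [apply: mulr_ge0|rewrite invr_ge0 exprn_ge0// ltW].
(* The half window []x, x + d[] lies in [Om], so the window has mass at least [d], of which the ring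
   in [row_slack] costs [d / 4]. *)
rewrite lerBrDr -(_ : x + d - x = 3 / 4 * d + d / 4); last by field.
rewrite -(@RI_itvo x (x + d)); [|lra..].
apply: le_Rintegral; [exact: mOm|by apply: int_natb; exact: itvo_ind_meas| |].
  by apply: int_natb; exact: Bi_meas.
move=> y _; rewrite ler_nat; case: andP => // -[h1 h2]; rewrite /Bi ger0_norm; last lra.
by rewrite (_ : _ <= _ = true)//; lra.
Qed.

Lemma row_layer_refl x : 1 - 7 / 8 * d < x < 1 ->
  Rintegral mu Om (fun y => `|Kd w d x y|) <=
  ad w d x - 7 / 256 * w (15 / 16) * d ^- 3 * (3 / 4 * d).
Proof.
move=> /andP[x0 x1]; have := d0 => d0'; have := d1 => d1'.
have Ox : Om x by rewrite /Om /= in_itv/=; apply/andP; split; lra.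
rewrite -ad_refl (RI_refl_Omega (int_abs (Kd_int Ox))).2.
have := @row_layer (1 - x) ltac:(by apply/andP; split; lra).
congr (_ <= _); apply: RI_eq => y _; rewrite -(Kd_refl _ Ox).
by rewrite subKr.
Qed.

Hypothesis H3 : A3 w d.

Lemma col_le x : Om x -> Rintegral mu Om (fun y => `|Kd w d y x|) <= ad w d x.
Proof.
move=> Ox; have mO := @mOm R.
have mKx : measurable_fun Om (fun y => Kd w d y x).
  rewrite (_ : (fun y => _) = (fun y => wd w d x y - bd w d y * (Bi x y)%R%:R)); last first.
    by apply/funext => y; rewrite KdE wd_sym /Bi distrC.
  apply: measurable_funB; first exact: wd_meas.
  by apply: measurable_funM; [exact: bd_meas|exact: Bi_meas].
have mt : measurable_fun Om (fun y => wtd w d y x).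
  rewrite (_ : (fun y => _) = (fun y => `|wd w d x y - bd w d y * ((0 < `|y - x|) && (`|y - x| < d))%R%:R|)); last first.
    by apply/funext => y; rewrite /wtd wd_sym (distrC x y); case: ifP.
  apply: measurableT_comp => //.
  apply: measurable_funB; first exact: wd_meas.
  apply: measurable_funM; first exact: bd_meas.
  by apply: meas_and_ind; apply: meas_lt_ind => //; exact: dist_meas.
have e : (\int[mu]_(y in Om) (wtd w d y x)%:E = \int[mu]_(y in Om) `|Kd w d y x|%:E)%E.
  apply: ae_eq_integral => //.
  - exact/measurable_EFinP.
  - by apply/measurable_EFinP; apply: measurableT_comp.
  (* The closed window of [Kd] and the punctured open window of [wtd] differ only at [y = x],
     [y = x + d] and [y = x - d]. *)
  apply: filterS (filterI (ae_neq x) (filterI (ae_neq (x + d)) (ae_neq (x - d)))) => y [n0 [n1 n2]] _; congr (`|_|%:E); rewrite /Kd; congr (_ - _ * _).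
  have -> : 0 < `|x - y| by rewrite normr_gt0 subr_eq0; apply/eqP => h; apply: n0.
  rewrite /= lt_neqAle; suff -> : `|x - y| != d by [].
  apply/eqP; rewrite -[RHS](ger0_norm (ltW d0)) => /eqP; rewrite eqr_norm2.
  by move=> /orP[]/eqP h; [apply: n2|apply: n1]; lra.
have := H3 Ox; rewrite e -lee_fin; congr (_ <= _)%E.
rewrite /Rintegral fineK//.
suff I : Lint Om (fun y => `|Kd w d y x|) by exact: (integrable_fin_num mO I).
by apply: int_abs; apply: (@int_Om _ (3 * (d ^- 3 * w 0))) => // y Oy; exact: Kd_max.
Qed.
End Rows.

(** * Stability *)

Section Schur.
Variable R : realType.
Local Notation mu := (@lebesgue_measure R).
Local Notation Lint D f := (mu.-integrable D (EFin \o f)).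
Local Notation T := (measurableTypeR R).
Local Notation Om := (@Omega R : set T).
Implicit Types (D E : set T) (f g h : T -> R).
Variable w : R -> R.
Hypothesis Hw : A1 w.
Variable d : R.
Hypotheses (d0 : 0 < d) (d1 : d < 2^-1).
Hypotheses (H2 : A2s w d) (H3 : A3 w d).

(** Half of the lower bound for [wd] on the shear set; the other half pays for [bd], see
    [Kd_shear]. *)
Definition kap : R := d ^- 3 * w (1 / 2) / 2.
Local Notation k0 := kap.
(** A step of length [d / 4] to the right lowers it by [d^2 / 256]. On [Om] it is at most [d / 32],
    so twice its square is at most [d^2 / 512]: the divisor 64 makes the drop twice the quadratic
    cost. *)
Definition slope (x : R) : R := d * (2 - x) / 64.
Local Notation lam := slope.
(** Steps shorter than [d / 2] keep [wd] large, steps longer than [d / 4] make [slope] drop; the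
    range of [x] keeps [y] inside [Om] and [bd] small. *)
Definition shear (x y : R) : bool :=
  (7 / 8 * d <= x <= 1 - 7 / 8 * d) && (x - d / 2 < y < x - d / 4).

Let k0_ge0 : 0 <= k0.
Proof. by apply: divr_ge0 => //; exact: dw_ge0. Qed.

Lemma shear_meas D (p q : T -> R) : measurable_fun D p -> measurable_fun D q ->
  measurable_fun D (fun z => (shear (p z) (q z))%R%:R : R).
Proof.
move=> mp mq; apply: meas_and_ind; apply: meas_and_ind;
  [apply: meas_le_ind|apply: meas_le_ind|apply: meas_lt_ind|apply: meas_lt_ind] => //;
  by apply: measurable_funB.
Qed.

Lemma shear_meas2 : measurable_fun (Om `*` Om) (fun z : T * T => (shear z.1 z.2)%R%:R : R).
Proof.
have m1 : measurable_fun (Om `*` Om) (fun z : T * T => z.1).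
  by apply: measurable_funTS; exact: measurable_fst.
have m2 : measurable_fun (Om `*` Om) (fun z : T * T => z.2).
  by apply: measurable_funTS; exact: measurable_snd.
apply: meas_and_ind; apply: meas_and_ind;
  [apply: meas_le_ind|apply: meas_le_ind|apply: meas_lt_ind|apply: meas_lt_ind];
  by [|apply: measurable_funB].
Qed.

(** At depth at least [7/8 d] inside a layer the factor [2 (d - z) / d] of [bd_le_left] is at most
    [1/4], and [w (7/8) <= w (1/2)], so [bd] takes away at most half of [wd]. *)
Lemma Kd_shear x y : Om x -> shear x y -> k0 <= Kd w d x y.
Proof.
have := d0 => d0'; have := d1 => d1'.
move=> Ox /andP[/andP[x1 x2] /andP[y1 y2]].
have L : d ^- 3 * w (1 / 2) <= wd w d x y.
  by apply: wd_ge => //; rewrite ger0_norm; lra.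
have mono : d ^- 3 * w (7 / 8) <= d ^- 3 * w (1 / 2).
  rewrite ler_wpM2l ?invr_ge0 ?exprn_ge0//; first exact: ltW.
  by apply: w_mono => //; lra.
have LL z : Om z -> 7 / 8 * d <= z < d -> bd w d z <= d ^- 3 * w (1 / 2) / 2.
  move=> Oz /andP[z1 z2].
  have z0 : 0 < z < d by apply/andP; split; lra.
  have q0 : 0 <= d ^- 3 * w (7 / 8) by apply: dw_ge0.
  have := bd_le_left Hw d0 d1 z0 (r := 7 / 8) ltac:(lra) z1.
  have c : 2 * (d - z) / d <= 1 / 4 by rewrite ler_pdivrMr//; lra.
  have := ler_wpM2r q0 c.
  lra.
have B : bd w d x <= k0.
  rewrite /k0; have [xd|dx] := ltP x d; first by apply: LL => //; rewrite x1.
  have [xd|xd] := ltP (1 - d) x; last by rewrite bd_mid.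
  rewrite -(bd_refl Hw d0 d1 Ox); apply: LL; first exact: Om_refl.
  by apply/andP; split; lra.
have b0 := bd_ge0 Hw d0 d1 Ox.
rewrite KdE; case: (Bi d x y); rewrite ?mulr1 ?mulr0.
  by move: B L; rewrite /k0; lra.
by move: L B b0; rewrite /k0; lra.
Qed.

(** Schur weights attached to the square of the row variable and, in [SF2], of the column variable.
    On the shear set only the part [kap] of [Kd] is reweighted; the rest [Kd - kap], nonnegative
    there, keeps equal weights. *)
Definition SF1 (x y : R) : R := `|Kd w d x y| - k0 * lam x * (shear x y)%R%:R.
Definition SF2 (x y : R) : R := `|Kd w d x y| + k0 * (lam x + 2 * lam x ^+ 2) * (shear x y)%R%:R.
Local Notation F1 := SF1.
Local Notation F2 := SF2.

(* On the shear set the pair of weights [1 - lam] and [1 + lam + 2 lam^2] has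
   product at least [1], hence [s t] is bounded by their half-sum. *)
Lemma schur x y s t : Om x -> Kd w d x y * s * t <= 2^-1 * (F1 x y * s ^+ 2 + F2 x y * t ^+ 2).
Proof.
move=> Ox; have h0 : forall z : R, z * s * t <= 2^-1 * `|z| * (s ^+ 2 + t ^+ 2).
  move=> z; have := sqr_ge0 (s - t); have := sqr_ge0 (s + t).
  have [z0|z0] := leP 0 z; [rewrite ger0_norm//|rewrite ltr0_norm//]; nra.
have := h0 (Kd w d x y); rewrite /F1 /F2; case: (boolP (shear x y)) => [S|_] /=; last by lra.
have K := Kd_shear Ox S; have := d0 => d0'; have := d1 => d1'.
move=> _; move: Ox; rewrite /Om /= in_itv/= => /andP[x0 x1].
rewrite ger0_norm; last exact: le_trans K.
have l0 : 0 <= lam x by rewrite /lam divr_ge0// mulr_ge0; lra.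
have l1 : lam x <= 2^-1 by rewrite /lam; nra.
move: (lam x) l0 l1 => l l0 l1.
have key : s * t <= 2^-1 * ((1 - l) * s ^+ 2 + (1 + l + 2 * l ^+ 2) * t ^+ 2).
  have p : 0 < 1 - l by lra.
  rewrite -(ler_pM2l p); have := sqr_ge0 ((1 - l) * s - t).
  (* The surplus in [(1 - l) * (1 + l + 2 * l^2) = 1 + l^2 * (1 - 2 * l)], nonnegative for
     [l <= 1/2]. *)
  have : 0 <= l ^+ 2 * (1 - 2 * l) * t ^+ 2.
    by apply: mulr_ge0; [apply: mulr_ge0; [exact: sqr_ge0|lra]|exact: sqr_ge0].
  nra.
have := h0 (Kd w d x y - k0); rewrite ger0_norm ?subr_ge0// => h1.
have := ler_wpM2l k0_ge0 key; move: h1; lra.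
Qed.

(** The interior gain [kap * (d^2 / 512) * (d / 4)], in which all powers of [d] cancel. *)
Definition coer : R := w (1 / 2) / 4096.
Local Notation c := coer.
Hypothesis d2 : w (1 / 2) * d / 128 + c * d ^+ 2 <= 3 / 4 * (7 / 256 * w (15 / 16)).

Let lam_bnd x : Om x -> 0 <= lam x /\ lam x <= d / 32.
Proof.
have := d0 => d0'; rewrite /Om /= in_itv/= /lam => /andP[x0 x1].
by split; [apply: divr_ge0 => //; apply: mulr_ge0; lra|nra].
Qed.

Let c1 x := lam x + 2 * lam x ^+ 2.

Let c1_bnd x : Om x -> 0 <= c1 x /\ c1 x <= d / 16.
Proof.
move=> Ox; have [l0 l1] := lam_bnd Ox; have := d0 => d0'; have := d1 => d1'.
rewrite /c1; split; nra.
Qed.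

Lemma int_shear1 x : Lint Om (fun y => (shear x y)%R%:R).
Proof. by apply: int_natb; apply: shear_meas. Qed.

Let lam_meas D : measurable_fun D lam.
Proof. by rewrite /lam; apply: measurable_funM => //; apply: measurable_funM => //; exact: measurable_funB. Qed.

Let c1_meas D : measurable_fun D c1.
Proof.
apply: measurable_funD => //; apply: measurable_funM => //.
exact: measurable_funX.
Qed.

Lemma Kd_meas1 y : Om y -> measurable_fun Om (fun x => Kd w d x y).
Proof.
move=> Oy; rewrite (_ : (fun z => _) = (fun z => wd w d y z - bd w d z * (Bi d y z)%R%:R)); last first.
  by apply/funext => z; rewrite KdE wd_sym /Bi distrC.
apply: measurable_funB; first exact: wd_meas.
by apply: measurable_funM; [exact: bd_meas|exact: Bi_meas].
Qed.

Lemma Kd_int1 y : Om y -> Lint Om (fun x => Kd w d x y).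
Proof.
move=> Oy; apply: (@int_Om _ _ (3 * (d ^- 3 * w 0))) => [|x Ox]; first exact: Kd_meas1.
exact: Kd_max.
Qed.

Let int_c1s y : Lint Om (fun x => c1 x * (shear x y)%R%:R).
Proof.
apply: (@int_Om _ _ (d / 16)) => [|x Ox]; first by apply: measurable_funM => //; exact: shear_meas.
have [h1 h2] := c1_bnd Ox; rewrite normrM ger0_norm//.
by rewrite -[leRHS]mulr1; apply: ler_pM => //; exact: natb_le1.
Qed.

Lemma F1_RI x : Om x -> Rintegral mu Om (F1 x) =
  Rintegral mu Om (fun y => `|Kd w d x y|) - k0 * lam x * Rintegral mu Om (fun y => (shear x y)%R%:R).
Proof.
move=> Ox; have mO := @mOm R; have Is := int_shear1 x.
rewrite -(RintegralZl (k0 * lam x) mO Is) -RintegralB//.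
  by apply: int_abs; exact: Kd_int.
exact: int_scale.
Qed.

Lemma F2_RI y : Om y -> Rintegral mu Om (fun x => F2 x y) =
  Rintegral mu Om (fun x => `|Kd w d x y|) + k0 * Rintegral mu Om (fun x => c1 x * (shear x y)%R%:R).
Proof.
move=> Oy; have mO := @mOm R; have Is := int_c1s y.
rewrite -(RintegralZl k0 mO Is) -RintegralD//.
- by apply: RI_eq => x _; rewrite /F2 mulrA.
- by apply: int_abs; exact: Kd_int1.
exact: int_scale.
Qed.

(** For fixed [y] the shear set confines [x] to an interval of length [d / 4]. *)
Lemma c1s_le y (b : R) : Om y -> 0 <= b ->
  (forall x, Om x -> shear x y -> c1 x <= b) ->
  Rintegral mu Om (fun x => c1 x * (shear x y)%R%:R) <= b * (d / 4).
Proof.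
move=> Oy b0 cb; have mO := @mOm R; have := d0 => d0'.
pose q (x : R) := (y + d / 4 < x < y + d / 2)%R%:R : R.
have Iq : Lint Om q by apply: int_natb; exact: itvo_ind_meas.
apply: (@le_trans _ _ (Rintegral mu Om (fun x => b * q x))).
  apply: le_Rintegral => //; first exact: int_scale.
  move=> x Ox; rewrite /q; case: (boolP (shear x y)) => [S|_] /=; last by rewrite mulr0 mulr_ge0.
  move: (S) => /andP[_ /andP[h1 h2]].
  have -> : y + d / 4 < x < y + d / 2 by apply/andP; split; lra.
  by rewrite !mulr1; exact: cb.
rewrite RintegralZl//; apply: ler_wpM2l => //.
by apply: le_trans (RI_itvo_le _) _; lra.
Qed.

Lemma dd : d ^- 3 * d ^+ 3 = 1.
Proof. by rewrite mulVf// expf_neq0// gt_eqF. Qed.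

Lemma kap_cube : k0 * d ^+ 3 = w (1 / 2) / 2.
Proof. by rewrite /k0 -[RHS]mul1r -dd; ring. Qed.

(** Multiplied by [d^2] this is [d2]: the slack of a layer row is of order [d^-2], the loss caused
    by the tilted weights only of order [d^-1]. *)
Let layer_arith : k0 * (d / 16 * (d / 4)) + c <= 7 / 256 * w (15 / 16) * d ^- 3 * (3 / 4 * d).
Proof.
rewrite -(@ler_pM2r _ (d ^+ 2)) ?exprn_gt0//.
have -> : 7 / 256 * w (15 / 16) * d ^- 3 * (3 / 4 * d) * d ^+ 2 = 3 / 4 * (7 / 256 * w (15 / 16)).
  by rewrite -[RHS]mul1r -dd; ring.
apply: le_trans d2; rewrite mulrDl.
have -> : k0 * (d / 16 * (d / 4)) * d ^+ 2 = k0 * d ^+ 3 * (d / 64) by field.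
by rewrite kap_cube; lra.
Qed.

Let layer_fin (a r k l s q h cc col e : R) : r <= a - e -> 0 <= k * l * s -> col <= a ->
  k * q <= k * h -> k * h + cc <= e -> r - k * l * s + (col + k * q) <= 2 * a - cc.
Proof. lra. Qed.

Let mid_fin (a r l q cc col t D : R) : r <= a -> col <= a ->
  k0 * q <= k0 * ((l - t) * D) -> k0 * t * D = cc ->
  r - k0 * l * D + (col + k0 * q) <= 2 * a - cc.
Proof. lra. Qed.

(** In a layer the gain of the row from the tilt is discarded and its loss in the column is bounded
    crudely; the slack of the row sum exceeds this loss by [coer]. *)
Lemma layer_sum z : Om z ->
  Rintegral mu Om (fun y => `|Kd w d z y|) <=
    ad w d z - 7 / 256 * w (15 / 16) * d ^- 3 * (3 / 4 * d) ->
  Rintegral mu Om (F1 z) + Rintegral mu Om (fun x => F2 x z) <= 2 * ad w d z - c.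
Proof.
move=> Oz L; rewrite F1_RI// F2_RI//.
have d16 : 0 <= d / 16 by rewrite divr_ge0// ltW.
have h : Rintegral mu Om (fun x => c1 x * (shear x z)%R%:R) <= d / 16 * (d / 4).
  by apply: c1s_le => // x Ox _; case: (c1_bnd Ox).
apply: (layer_fin L _ (col_le Hw d0 d1 H3 Oz) (ler_wpM2l k0_ge0 h) layer_arith).
have [l0 _] := lam_bnd Oz.
by apply: mulr_ge0; [exact: mulr_ge0|exact: Rintegral_ge0].
Qed.

Lemma shear_RI z : Om z -> 7 / 8 * d <= z <= 1 - 7 / 8 * d ->
  Rintegral mu Om (fun y => (shear z y)%R%:R) = d / 4.
Proof.
move=> Oz zz; have := d0 => d0'; have /andP[zl zr] := zz.
have -> : d / 4 = z - d / 4 - (z - d / 2) by field.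
rewrite -RI_itvo; [|lra|lra|lra].
by apply: RI_eq => y _; rewrite /shear zz.
Qed.

(** The column of [z] is met only from [x > z + d / 4], where [slope] has dropped by at least
    [d^2 / 256]; the term [2 * slope^2] gives back at most half of this. *)
Lemma c1_mid z : Om z -> 7 / 8 * d <= z <= 1 - 7 / 8 * d ->
  Rintegral mu Om (fun x => c1 x * (shear x z)%R%:R) <= (lam z - d ^+ 2 / 512) * (d / 4).
Proof.
move=> Oz zz; have := d0 => d0'; have := d1 => d1'; have /andP[zl zr] := zz.
apply: (c1s_le Oz); first by rewrite /lam; nra.
move=> x Ox /andP[_ /andP[h1 h2]]; have [a1 a2] := lam_bnd Ox.
have b1 : lam x <= lam z - d ^+ 2 / 256 by rewrite /lam; nra.
have b2 : 2 * lam x ^+ 2 <= d ^+ 2 / 512.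
  have -> : d ^+ 2 / 512 = 2 * (d / 32) ^+ 2 by field.
  by rewrite ler_pM2l// ler_pXn2r// nnegrE; lra.
by move: b1 b2; rewrite /c1; move: (lam x) (lam z) => p q; lra.
Qed.

(** In the middle the row of [z] gains [kap * slope z * (d / 4)] and its column loses at most this
    amount minus [coer]: the values of [slope] cancel and only its drop remains. *)
Lemma schur_sum z : Om z ->
  Rintegral mu Om (F1 z) + Rintegral mu Om (fun x => F2 x z) <= 2 * ad w d z - c.
Proof.
move=> Oz; have := Oz; rewrite /Om /= in_itv/= => /andP[z0 z1].
have [zl|zl] := ltP z (7 / 8 * d).
  by apply: layer_sum => //; apply: row_layer => //; rewrite z0.
have [zr|zr] := ltP (1 - 7 / 8 * d) z.
  by apply: layer_sum => //; apply: row_layer_refl => //; rewrite z1 andbT.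
have zz : 7 / 8 * d <= z <= 1 - 7 / 8 * d by rewrite zl zr.
rewrite F1_RI// F2_RI// shear_RI//.
apply: (mid_fin (row_le Hw d0 d1 H2 Oz) (col_le Hw d0 d1 H3 Oz) (ler_wpM2l k0_ge0 (c1_mid Oz zz))).
have -> : k0 * (d ^+ 2 / 512) * (d / 4) = k0 * d ^+ 3 / 2048 by field.
by rewrite kap_cube /c; field.
Qed.
End Schur.

(** * Coercivity of the quadratic form and the a priori estimate *)

Section Stability.
Variable R : realType.
Local Notation mu := (@lebesgue_measure R).
Local Notation Lint D f := (mu.-integrable D (EFin \o f)).
Local Notation T := (measurableTypeR R).
Local Notation Om := (@Omega R : set T).
Implicit Types (D E : set T) (f g h : T -> R).

Lemma RI_bnd f C : measurable_fun Om f -> (forall x, Om x -> `|f x| <= C) ->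
  `|Rintegral mu Om f| <= C.
Proof.
move=> mf fC; have mO := @mOm R; rewrite -[leRHS]RI_cst_Omega.
by apply: RI_abs_le => //; apply: (@int_Om _ _ `|C|).
Qed.

Variable w : R -> R.
Hypothesis Hw : A1 w.
Variable d : R.
Hypotheses (d0 : 0 < d) (d1 : d < 2^-1).

Lemma ad_bnd x : `|ad w d x| <= d ^- 3 * w 0.
Proof.
apply: RI_bnd => [|y _]; first exact: wd_meas.
by rewrite ger0_norm ?wd_ge0//; exact: wd_max.
Qed.

Lemma ad_meas : measurable_fun Om (ad w d).
Proof.
apply: int_meas; apply: (@dom_int_RI R (wd w d) (cst (d ^- 3 * w 0))).
- by apply: measurable_funTS; exact: wd_meas2.
- by apply: (@int_Om _ _ `|d ^- 3 * w 0|).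
- move=> x y _ _; rewrite ger0_norm ?wd_ge0//.
  by apply: (le_trans (wd_max Hw d0 x y)); rewrite lerDl; exact: dw_ge0.
Qed.

Variable v : T -> R.
Hypothesis mv : measurable_fun Om v.
Hypothesis Iv2 : Lint Om (fun x => v x ^+ 2).

Lemma L2_int : Lint Om v.
Proof.
have mO := @mOm R.
apply: (@int_dom R Om v (fun x => 1 + v x ^+ 2)) => //.
  by apply: int_add => //; apply: (@int_Om _ _ 1) => // x _; rewrite normr1.
move=> x _; have h1 := sqr_ge0 (v x - 1); have h2 := sqr_ge0 (v x + 1).
by rewrite ler_norml; apply/andP; split; nra.
Qed.

Definition Kvv (x y : R) : R := Kd w d x y * v x * v y.
Let C3 := 3 * (d ^- 3 * w 0).
Let C3_ge0 : 0 <= C3. Proof. by apply: mulr_ge0 => //; exact: dw_ge0. Qed.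
Let Ih C : Lint Om (fun x => C * v x ^+ 2).
Proof. by apply: int_scale => //; exact: mOm. Qed.
Let msq D : measurable_fun D v -> measurable_fun D (fun x => v x ^+ 2).
Proof. by move=> ?; exact: measurable_funX. Qed.

Lemma Kvv_meas : measurable_fun (Om `*` Om) (fun z : T * T => Kvv z.1 z.2).
Proof.
apply: measurable_funM; last exact: meas_snd.
by apply: measurable_funM; [exact: Kd_meas2|exact: meas_fst].
Qed.

Lemma Kvv_bnd x y : Om x -> Om y -> `|Kvv x y| <= C3 * v x ^+ 2 + C3 * v y ^+ 2.
Proof.
move=> Ox Oy; rewrite /Kvv -mulrA normrM -mulrDr; apply: ler_pM => //; first exact: Kd_max.
have h1 := sqr_ge0 (v x - v y); have h2 := sqr_ge0 (v x + v y).
have h3 := sqr_ge0 (v x); have h4 := sqr_ge0 (v y).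
by rewrite ler_norml; apply/andP; split; nra.
Qed.

Lemma Kv_int x : Om x -> Lint Om (fun y => Kd w d x y * v y).
Proof.
move=> Ox; apply: (@int_mulb R Om v (Kd w d x) C3) => //; [exact: mOm|exact: L2_int|exact: Kd_meas|].
by move=> y _; exact: Kd_max.
Qed.

Lemma Kvv_RI x : Om x -> Rintegral mu Om (Kvv x) =
  v x * Rintegral mu Om (fun y => v y * Kd w d x y).
Proof.
move=> Ox; have -> : Rintegral mu Om (fun y => v y * Kd w d x y) = Rintegral mu Om (fun y => Kd w d x y * v y).
  by apply: RI_eq => y _; exact: mulrC.
rewrite -(RintegralZl (v x) (@mOm R) (Kv_int Ox)).
by apply: RI_eq => y _; rewrite /Kvv; ring.
Qed.

Lemma Kvv_int : Lint Om (fun x => Rintegral mu Om (Kvv x)).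
Proof. exact: (dom_int_RI Kvv_meas (Ih C3) Kvv_bnd). Qed.

Let Iav : Lint Om (fun x => ad w d x * v x ^+ 2).
Proof.
by apply: (@int_mulb R Om _ (ad w d) (d ^- 3 * w 0)) => //; [exact: mOm|exact: ad_meas|move=> x _; exact: ad_bnd].
Qed.

Lemma vNd x : Om x -> v x * Nd w d v x = ad w d x * v x ^+ 2 - Rintegral mu Om (Kvv x).
Proof. by move=> Ox; rewrite Kvv_RI// /Nd; ring. Qed.

Hypotheses (H2 : A2s w d) (H3 : A3 w d).
Hypothesis d2 : w (1 / 2) * d / 128 + coer w * d ^+ 2 <= 3 / 4 * (7 / 256 * w (15 / 16)).

Local Notation F1 := (SF1 w d).
Local Notation F2 := (SF2 w d).
Let CF := C3 + kap w d.

Let kap_ge0 : 0 <= kap w d.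
Proof. by apply: divr_ge0 => //; apply: dw_ge0. Qed.

Let slope_bnd x : Om x -> 0 <= slope d x /\ slope d x <= 1 / 4.
Proof.
have := d0 => d0'; have := d1 => d1'; rewrite /Om /= in_itv/= /slope => /andP[x0 x1].
by split; [apply: divr_ge0 => //; apply: mulr_ge0; lra|nra].
Qed.

Let F1_bnd x y : Om x -> `|F1 x y| <= CF.
Proof.
move=> Ox; rewrite /SF1; apply: (le_trans (ler_normB _ _)); rewrite normr_id.
apply: lerD; first exact: Kd_max.
have [l0 l1] := slope_bnd Ox; rewrite normrM [X in X * _]ger0_norm; last exact: mulr_ge0.
rewrite -[leRHS]mulr1; apply: ler_pM => //; [exact: mulr_ge0| |exact: natb_le1].
rewrite -[leRHS]mulr1; apply: ler_pM => //; lra.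
Qed.

Let F2_bnd x y : Om x -> `|F2 x y| <= CF.
Proof.
move=> Ox; rewrite /SF2; apply: (le_trans (ler_normD _ _)); rewrite normr_id.
apply: lerD; first exact: Kd_max.
have [l0 l1] := slope_bnd Ox.
have s0 : 0 <= slope d x + 2 * slope d x ^+ 2 by rewrite addr_ge0// mulr_ge0// sqr_ge0.
rewrite normrM [X in X * _]ger0_norm; last exact: mulr_ge0.
rewrite -[leRHS]mulr1; apply: ler_pM => //; [exact: mulr_ge0| |exact: natb_le1].
rewrite -[leRHS]mulr1; apply: ler_pM => //.
by move: (slope d x) l0 l1 => l l0 l1; nra.
Qed.

Let slope_meas : measurable_fun Om (slope d).
Proof. by rewrite /slope; apply: measurable_funM => //; apply: measurable_funM => //; exact: measurable_funB. Qed.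

Let absK_meas2 : measurable_fun (Om `*` Om) (fun z : T * T => `|Kd w d z.1 z.2|).
Proof. by apply: measurableT_comp => //; exact: Kd_meas2. Qed.

Let F1_meas2 : measurable_fun (Om `*` Om) (fun z : T * T => F1 z.1 z.2).
Proof.
apply: measurable_funB; first exact: absK_meas2.
apply: measurable_funM; last exact: shear_meas2.
apply: (@meas_fst R (fun x => kap w d * slope d x)).
by apply: measurable_funM.
Qed.

Let F2_meas2 : measurable_fun (Om `*` Om) (fun z : T * T => F2 z.1 z.2).
Proof.
apply: measurable_funD; first exact: absK_meas2.
apply: measurable_funM; last exact: shear_meas2.
apply: (@meas_fst R (fun x => kap w d * (slope d x + 2 * slope d x ^+ 2))).
apply: measurable_funM => //; apply: measurable_funD => //; apply: measurable_funM => //.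
exact: measurable_funX.
Qed.

Let hF := fun x : T => CF * v x ^+ 2.
Let CF_ge0 : 0 <= CF. Proof. exact: addr_ge0. Qed.
Let cst_bnd (F : R -> R -> R) : (forall x y, Om x -> `|F x y| <= CF) ->
  forall x y, Om x -> Om y -> `|F x y| <= CF / 2 + CF / 2.
Proof. by move=> FC x y Ox _; rewrite -splitr; exact: FC. Qed.
Let Icst : Lint Om (fun _ : T => CF / 2).
Proof. exact: (@int_Om _ _ `|CF / 2|). Qed.

Let G1 x y := 2^-1 * (F1 x y * v x ^+ 2).
Let G2 x y := 2^-1 * (F2 x y * v y ^+ 2).

Let half_bnd (a b t : R) : `|a| <= CF -> 0 <= b -> 0 <= t -> `|2^-1 * (a * b)| <= CF * b + CF * t.
Proof.
move=> aC b0 t0; rewrite normrM (ger0_norm (x := 2^-1))// normrM (ger0_norm b0).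
have h := ler_wpM2r b0 aC; have h2 := mulr_ge0 CF_ge0 t0; have h3 := mulr_ge0 CF_ge0 b0.
lra.
Qed.

Let G1_bnd x y : Om x -> Om y -> `|G1 x y| <= hF x + hF y.
Proof. by move=> Ox Oy; apply: half_bnd; rewrite ?sqr_ge0//; exact: F1_bnd. Qed.
Let G2_bnd x y : Om x -> Om y -> `|G2 x y| <= hF x + hF y.
Proof. by move=> Ox Oy; rewrite addrC; apply: half_bnd; rewrite ?sqr_ge0//; exact: F2_bnd. Qed.
Let G1_meas2 : measurable_fun (Om `*` Om) (fun z : T * T => G1 z.1 z.2).
Proof.
apply: measurable_funM => //; apply: measurable_funM; first exact: F1_meas2.
by apply: (@meas_fst R (fun x => v x ^+ 2)); exact: msq.
Qed.
Let G2_meas2 : measurable_fun (Om `*` Om) (fun z : T * T => G2 z.1 z.2).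
Proof.
apply: measurable_funM => //; apply: measurable_funM; first exact: F2_meas2.
by apply: (@meas_snd R (fun x => v x ^+ 2)); exact: msq.
Qed.

Lemma quad_le : Rintegral mu Om (fun x => Rintegral mu Om (Kvv x)) <=
  Rintegral mu Om (fun z => (ad w d z - coer w / 2) * v z ^+ 2).
Proof.
have mO := @mOm R; have IhF : Lint Om hF := Ih CF.
have I1 : Lint Om (fun x => Rintegral mu Om (G1 x)) := dom_int_RI G1_meas2 IhF G1_bnd.
have I2 : Lint Om (fun x => Rintegral mu Om (G2 x)) := dom_int_RI G2_meas2 IhF G2_bnd.
have G2_bnd' x y : Om x -> Om y -> `|G2 y x| <= hF x + hF y.
  by move=> Ox Oy; rewrite addrC; exact: G2_bnd.
have I2' : Lint Om (fun y => Rintegral mu Om (fun x => G2 x y)).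
  exact: (dom_int_RI (F := fun y x => G2 x y) (meas_swap G2_meas2) IhF G2_bnd').
apply: (@le_trans _ _ (Rintegral mu Om (fun x => Rintegral mu Om (G1 x) + Rintegral mu Om (G2 x)))).
  apply: le_Rintegral => //; first exact: Kvv_int; first exact: int_add.
  move=> x Ox.
  have J1 := dom_int_y G1_meas2 IhF G1_bnd Ox.
  have J2 := dom_int_y G2_meas2 IhF G2_bnd Ox.
  rewrite -RintegralD//; apply: le_Rintegral => //; last first.
  - move=> y Oy; rewrite /Kvv /G1 /G2 -mulrDr.
    exact: schur.
  - exact: int_add.
  - exact: (dom_int_y Kvv_meas (Ih C3) Kvv_bnd Ox).
rewrite RintegralD//.
(* Exchanging the order turns the part with [v y ^+ 2] into column sums; then both parts carry the
   factor [v z ^+ 2] and [schur_sum] applies at each [z]. *)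
have -> : Rintegral mu Om (fun x => Rintegral mu Om (G2 x)) =
    Rintegral mu Om (fun y => Rintegral mu Om (fun x => G2 x y)).
  exact: (fubini_dom G2_meas2 IhF G2_bnd).
rewrite -RintegralD//; apply: le_Rintegral => //; first exact: int_add.
  apply: (@eq_int R Om (fun z => ad w d z * v z ^+ 2 - coer w / 2 * v z ^+ 2)) => //.
    by move=> z _; rewrite mulrBl.
  by apply: int_sub => //; exact: Ih.
move=> z Oz.
have J1 : Lint Om (F1 z) := dom_int_y F1_meas2 Icst (cst_bnd F1_bnd) Oz.
have J2 : Lint Om (fun x => F2 x z).
  apply: (@int_Om _ _ CF) => [|x Ox]; last exact: F2_bnd.
  exact: (int_meas (dom_int_y (F := fun y x => F2 x y) (meas_swap F2_meas2) Icst
     (fun y x Oy Ox => cst_bnd F2_bnd Ox Oy) Oz)).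
have e1 : Rintegral mu Om (G1 z) = 2^-1 * v z ^+ 2 * Rintegral mu Om (F1 z).
  by rewrite -(RintegralZl _ mO J1); apply: RI_eq => y _; rewrite /G1; ring.
have e2 : Rintegral mu Om (fun x => G2 x z) = 2^-1 * v z ^+ 2 * Rintegral mu Om (fun x => F2 x z).
  by rewrite -(RintegralZl _ mO J2); apply: RI_eq => y _; rewrite /G2; ring.
rewrite e1 e2 -mulrDr.
have := schur_sum Hw d0 d1 H2 H3 d2 Oz.
have q : 0 <= 2^-1 * v z ^+ 2 by rewrite mulr_ge0// sqr_ge0.
move=> /(ler_wpM2l q) h; apply: (le_trans h).
by rewrite le_eqVlt; apply/orP; left; apply/eqP; field.
Qed.

Lemma coer_gt0 : 0 < coer w.
Proof.
have : 0 < w (1 / 2) by apply: (w_gt0 Hw); apply/andP; split; lra.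
by rewrite /coer; lra.
Qed.

(** Coercivity bounds [coer / 2] times the squared norm by the pairing of [v] with [Nd v], and
    Young's inequality sacrifices half of it. The integrable majorant [Q] stands in for the square
    of [Nd v], so that pointwise error bounds can be inserted directly. *)
Lemma stability (Q : T -> R) : Lint Om Q ->
  {ae mu, forall x, Om x -> Nd w d v x ^+ 2 <= Q x} ->
  coer w ^+ 2 / 4 * Rintegral mu Om (fun x => v x ^+ 2) <= Rintegral mu Om Q.
Proof.
move=> IQ NQ; have mO := @mOm R; have c0 := coer_gt0.
have IvN : Lint Om (fun x => v x * Nd w d v x).
  apply: (@eq_int R Om (fun x => ad w d x * v x ^+ 2 - Rintegral mu Om (Kvv x))) => //.
    by move=> x Ox; rewrite vNd.
  by apply: int_sub => //; exact: Kvv_int.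
set V := Rintegral mu Om (fun x => v x ^+ 2).
have lower : coer w / 2 * V <= Rintegral mu Om (fun x => v x * Nd w d v x).
  rewrite (RI_eq (fun x Ox => vNd Ox)) RintegralB//; last exact: Kvv_int.
  have := quad_le.
  have -> : Rintegral mu Om (fun z => (ad w d z - coer w / 2) * v z ^+ 2) =
      Rintegral mu Om (fun z => ad w d z * v z ^+ 2) - coer w / 2 * V.
    rewrite -(RintegralZl (coer w / 2) mO Iv2) -(RintegralB mO Iav (Ih (coer w / 2))).
    by apply: RI_eq => z _; exact: mulrBl.
  by lra.
have IcQ : Lint Om (fun x => (coer w)^-1 * Q x) by exact: int_scale.
have upper : Rintegral mu Om (fun x => v x * Nd w d v x) <=
    Rintegral mu Om (fun x => coer w / 4 * v x ^+ 2 + (coer w)^-1 * Q x).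
  apply: RI_le_ae => //; first exact: int_add.
  apply: filterS NQ => x h Ox; have := h Ox => {}h.
  move: (v x) (Nd w d v x) (Q x) h => p q r h.
  have : (coer w)^-1 * q ^+ 2 <= (coer w)^-1 * r by rewrite ler_pM2l// invr_gt0.
  suff : 0 <= (coer w)^-1 * (coer w / 2 * p - q) ^+ 2.
    have -> : (coer w)^-1 * (coer w / 2 * p - q) ^+ 2 =
       coer w / 4 * p ^+ 2 - p * q + (coer w)^-1 * q ^+ 2 by field; rewrite gt_eqF.
    by move=> h1 h2; lra.
  by rewrite mulr_ge0 ?sqr_ge0// invr_ge0 ltW.
have := le_trans lower upper.
rewrite (RintegralD mO (Ih (coer w / 4)) IcQ) (RintegralZl (coer w / 4) mO Iv2).
rewrite (RintegralZl (coer w)^-1 mO IQ) -/V => h.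
have {}h : coer w / 4 * V <= (coer w)^-1 * Rintegral mu Om Q by lra.
rewrite -(@ler_pM2l _ (coer w)^-1) ?invr_gt0//.
by apply: le_trans h; rewrite le_eqVlt; apply/orP; left; apply/eqP; field; rewrite gt_eqF.
Qed.
End Stability.

(** * Consistency *)

Section Consist.
Variable R : realType.
Local Notation mu := (@lebesgue_measure R).
Local Notation Lint D f := (mu.-integrable D (EFin \o f)).
Local Notation T := (measurableTypeR R).
Local Notation Om := (@Omega R : set T).
Implicit Types (D E : set T) (f g h : T -> R).
Variable w : R -> R.
Hypothesis Hw : A1 w.
Variable d : R.
Hypotheses (d0 : 0 < d) (d1 : d < 2^-1).

Let mO := @mOm R.

(** Collecting [ad * v x] with the [wd] part leaves differences of [v], to which Taylor's formula
    applies; the correction stays separate. *)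
Lemma NdE v x : Om x -> Lint Om v ->
  Nd w d v x = Rintegral mu Om (fun y => (v x - v y) * wd w d x y) +
    bd w d x * Rintegral mu Om (fun y => v y * (Bi d x y)%R%:R).
Proof.
move=> Ox Iv.
have Iw := wd_intO Hw d0 x.
have Ivw : Lint Om (fun y => wd w d x y * v y).
  apply: (int_mulb (C := d ^- 3 * w 0) mO Iv); first exact: wd_meas.
  by move=> y _; rewrite ger0_norm ?wd_ge0//; exact: wd_max.
have IvB : Lint Om (fun y => (Bi d x y)%R%:R * v y).
  by apply: (int_mulb (C := 1) mO Iv) => [|y _]; [exact: Bi_meas|exact: natb_le1].
have Ia : Lint Om (fun y => v x * wd w d x y) by exact: int_scale.
have -> : Rintegral mu Om (fun y => v y * (Bi d x y)%R%:R) =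
  Rintegral mu Om (fun y => (Bi d x y)%R%:R * v y) by apply: RI_eq => y _; exact: mulrC.
rewrite -(RintegralZl (bd w d x) mO IvB).
have Ib := int_scale (bd w d x) mO IvB.
have -> : Rintegral mu Om (fun y => (v x - v y) * wd w d x y) =
    v x * ad w d x - Rintegral mu Om (fun y => wd w d x y * v y).
  rewrite -(RintegralZl (v x) mO Iw) -(RintegralB mO Ia Ivw).
  by apply: RI_eq => y _; rewrite mulrBl [X in _ - X]mulrC.
rewrite /Nd -addrA mulrC; congr (_ + _).
rewrite -[LHS]opprK -[RHS]opprK; congr (- _); rewrite opprK opprD opprK.
rewrite -(RintegralB mO Ivw Ib); apply: RI_eq => y _; rewrite KdE; ring.
Qed.

Lemma Nd_refl v x : Om x -> Lint Om v ->
  Nd w d v (1 - x) = Nd w d (fun y => v (1 - y)) x.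
Proof.
move=> Ox Iv; rewrite /Nd ad_refl//; congr (_ - _).
have I : Lint Om (fun y => v y * Kd w d (1 - x) y).
  apply: (@eq_int R Om (fun y => Kd w d (1 - x) y * v y)) => //.
    by move=> y _; exact: mulrC.
  apply: (int_mulb (C := 3 * (d ^- 3 * w 0)) mO Iv); first exact: Kd_meas.
  by move=> y _; apply: Kd_max => //; exact: Om_refl.
rewrite (RI_refl_Omega I).2; apply: RI_eq => y _.
by rewrite Kd_refl.
Qed.

Lemma sq_wd_intO x : Lint Om (fun y => (y - x) ^+ 2 * wd w d x y).
Proof. by apply: integrableS (wd_mom2 Hw d0 x).1. Qed.

Lemma lin_wd_intO x : Lint Om (fun y => (y - x) * wd w d x y).
Proof. by apply: integrableS (wd_mom1_int Hw d0 x). Qed.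

Lemma sq_wd_RI_le x : Rintegral mu Om (fun y => (y - x) ^+ 2 * wd w d x y) <= 2.
Proof.
rewrite -(wd_mom2 Hw d0 x).2; apply: RI_subset => //; first exact: (wd_mom2 Hw d0 x).1.
by move=> y _; rewrite mulr_ge0 ?sqr_ge0 ?wd_ge0.
Qed.

Let far x y : d <= x <= 1 - d -> ~ Om y -> wd w d x y = 0.
Proof.
move=> /andP[x0 x1] nO; apply: wd_eq0 => //.
have := d0 => d0'; have [y0|y0] := leP y 0; first by rewrite ger0_norm; lra.
have [y1|y1] := leP 1 y; first by rewrite ler0_norm; lra.
by exfalso; apply: nO; rewrite /Omega /= in_itv/= y0 y1.
Qed.

Lemma sq_wd_RI x : d <= x <= 1 - d -> Rintegral mu Om (fun y => (y - x) ^+ 2 * wd w d x y) = 2.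
Proof.
move=> xx; rewrite -(wd_mom2 Hw d0 x).2; apply: RI_restr => // y _ nO.
by rewrite far ?mulr0.
Qed.

Lemma lin_wd_RI x : d <= x <= 1 - d -> Rintegral mu Om (fun y => (y - x) * wd w d x y) = 0.
Proof.
move=> xx; rewrite -(wd_mom1 Hw d0 x); apply: RI_restr => // y _ nO.
by rewrite far ?mulr0.
Qed.

(** The first moment over the whole line is zero, and for [x] in the left layer the only part of the
    kernel outside [Om] lies over [[-1, 0]]. *)
Lemma lin_wd_left x : 0 < x < d -> Rintegral mu Om (fun y => (y - x) * wd w d x y) = Ph w d x.
Proof.
move=> /andP[x0 xd]; have := d0 => d0'; have := d1 => d1'.
have mI : measurable (`[-1, 0]%classic : set T) by exact: measurable_itv.
have := wd_mom1 Hw d0 x.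
rewrite -(@RI_restr R (Om `|` `[-1, 0]%classic)) //; last first.
  move=> y _ nO; rewrite wd_eq0 ?mulr0//.
  have [y0|y0] := leP y 0.
    have [y1|y1] := leP (-1) y; first by exfalso; apply: nO; right; rewrite /= in_itv/= y0 y1.
    by rewrite ger0_norm; lra.
  have [y1|y1] := leP 1 y; first by rewrite ler0_norm; lra.
  by exfalso; apply: nO; left; rewrite /Omega /= in_itv/= y0 y1.
rewrite Rintegral_setU//; last 2 first.
- by apply: integrableS (wd_mom1_int Hw d0 x) => //; exact: measurableU.
- apply/disj_setPS => y [] /=; rewrite /Omega /= !in_itv/= => /andP[y0 _] /andP[_ y1].
  by lra.
have -> : Rintegral mu `[-1, 0] (fun y => (y - x) * wd w d x y) = - Ph w d x.
  have Il := wd_lin_intS Hw d0 x mI.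
  rewrite /Ph -[RHS]mulN1r -(RintegralZl (-1) mI Il).
  by apply: RI_eq => y _; ring.
by move=> /eqP; rewrite subr_eq0 => /eqP.
Qed.

(** The reflection [y -> s - y] preserves the integral, and the two integrands add up to [s] on []0,
    s[]. *)
Lemma RI_lin (s : R) : 0 < s < 1 -> Rintegral mu Om (fun y => y * (0 < y < s)%R%:R) = s ^+ 2 / 2.
Proof.
move=> /andP[s0 s1].
have mi (D : set T) : measurable_fun D (fun y : T => (0 < y < s)%R%:R : R) by exact: itvo_ind_meas.
pose F (y : T) : R := y * (0 < y < s)%R%:R.
have sub (y : T) : ~ Om y -> (0 < y < s) = false.
  move=> nO; apply/negP => /andP[y0 ys]; apply: nO.
  by rewrite /Omega /= in_itv/=; apply/andP; split; lra.
have IFO : Lint Om F.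
  apply: (@int_Om _ _ 1) => [|y Oy]; first by apply: measurable_funM.
  move: Oy; rewrite /Omega /= in_itv/= => /andP[y0 y1].
  rewrite /F normrM -[leRHS]mulr1; apply: ler_pM => //; last exact: natb_le1.
  by rewrite ger0_norm; lra.
have IF : Lint setT F.
  by apply/(@int_restr R Om setT) => // y _ nO; rewrite /F sub ?mulr0.
have [I2 e2] := RI_refl s IF.
have eO : Rintegral mu Om F = Rintegral mu setT F.
  by apply: RI_restr => // y _ nO; rewrite /F sub ?mulr0.
have : Rintegral mu setT F + Rintegral mu setT (fun y => F (s - y)) = s * s.
  rewrite -RintegralD//.
  have -> : s * s = Rintegral mu setT (fun y => s * (0 < y < s)%R%:R).
    rewrite -[RHS](@RI_restr R Om) //; last by move=> y _ nO; rewrite sub ?mulr0.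
    rewrite RintegralZl ?RI_itvo//; [|lra|lra|exact: int_natb].
    by rewrite subr0.
  apply: RI_eq => y _; rewrite /F.
  have -> : (0 < s - y < s) = (0 < y < s) by apply/andP/andP => -[h1 h2]; split; lra.
  by ring.
by rewrite -e2 -/F -eO; lra.
Qed.

Section Consistency.
Variables (v p g : R -> R) (e C : R).
Hypotheses (mv : measurable_fun Om v) (Iv : Lint Om v).
Hypothesis C0 : 0 <= C.

(** The window lies in the closure of [Om], so the moments 0 and 2 turn the Taylor polynomial into
    exactly [g x], and the remainder bound [e * (y - x)^2] into [2 * e]. *)
Lemma cons_interior x : d <= x <= 1 - d -> Om x ->
  (forall y, Om y -> `|y - x| <= d ->
    `|v y - v x - p x * (y - x) + g x / 2 * (y - x) ^+ 2| <= e * (y - x) ^+ 2) ->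
  `|Nd w d v x - g x| <= 2 * e.
Proof.
move=> xx Ox Tay; have /andP[x0 x1] := xx.
rewrite NdE// bd_mid// mul0r addr0.
have I2 := sq_wd_intO x; have I1 := lin_wd_intO x.
pose r y := v y - v x - p x * (y - x) + g x / 2 * (y - x) ^+ 2.
have mr : measurable_fun Om (fun y : T => - r y * wd w d x y).
  apply: measurable_funM; last exact: wd_meas.
  apply: measurable_funN; apply: measurable_funD.
    by apply: measurable_funB; [exact: measurable_funB|apply: measurable_funM => //; exact: measurable_funB].
  by apply: measurable_funM => //; apply: measurable_funX; exact: measurable_funB.
have Ie := int_scale e mO I2.
have rb y : Om y -> `|- r y * wd w d x y| <= e * ((y - x) ^+ 2 * wd w d x y).
  move=> Oy; rewrite normrM normrN (ger0_norm (wd_ge0 Hw d0 x y)) mulrA.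
  have [h|h] := leP `|y - x| d; first by apply: ler_wpM2r; [exact: wd_ge0|exact: Tay].
  by rewrite wd_eq0 ?mulr0// distrC ltW.
have Ir := int_dom mO mr Ie rb.
have Ip := int_scale (- p x) mO I1; have Ig := int_scale (g x / 2) mO I2.
have -> : Rintegral mu Om (fun y => (v x - v y) * wd w d x y) =
   Rintegral mu Om (fun y => - r y * wd w d x y) + g x.
  rewrite -[X in _ + X]add0r -{1}(mulr0 (- p x)) -(lin_wd_RI xx).
  rewrite -(RintegralZl (- p x) mO I1).
  have -> : g x = g x / 2 * 2 by field.
  rewrite -{2}(sq_wd_RI xx) -(RintegralZl (g x / 2) mO I2).
  rewrite -(RintegralD mO Ip Ig) -(RintegralD mO Ir (int_add mO Ip Ig)).
  by apply: RI_eq => y _; rewrite /r; field.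
rewrite addrK; apply: (le_trans (RI_abs_le mO mr Ie rb)).
by rewrite (RintegralZl e mO I2) sq_wd_RI// mulrC.
Qed.

Hypothesis T1 : forall x y, 0 < x < 1 -> 0 <= y < 1 ->
  `|v y - v x - p x * (y - x)| <= C * (y - x) ^+ 2.
Hypothesis v0 : v 0 = 0.

(* The weighted first moment of [wd] over [Om] is [Ph], and [bd] is normalised
   so that its own contribution [bd * p x * (x + d)^2 / 2] is [p x * Ph] too:
   the terms of order [1 / d] cancel. *)
Lemma cons_left x : 0 < x < d -> `|Nd w d v x| <= 2 * C + 8 * C * w 0.
Proof.
move=> xx; have /andP[x0 xd] := xx; have := d0 => d0'; have := d1 => d1'.
have Ox : Om x by rewrite /Omega /= in_itv/=; apply/andP; split; lra.
have x01 : 0 < x < 1 by apply/andP; split; lra.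
rewrite NdE//.
have I2 := sq_wd_intO x; have I1 := lin_wd_intO x.
pose r y := v y - v x - p x * (y - x).
have mr0 : measurable_fun Om r.
  by apply: measurable_funB; [exact: measurable_funB|apply: measurable_funM => //; exact: measurable_funB].
have rC y : Om y -> `|r y| <= C * (y - x) ^+ 2.
  by rewrite /Omega /= in_itv/= => /andP[y0 y1]; apply: T1 => //; rewrite y1 ltW.
have mr : measurable_fun Om (fun y : T => r y * wd w d x y).
  by apply: measurable_funM => //; exact: wd_meas.
have IC := int_scale C mO I2.
have rb y : Om y -> `|r y * wd w d x y| <= C * ((y - x) ^+ 2 * wd w d x y).
  move=> Oy; rewrite normrM (ger0_norm (wd_ge0 Hw d0 x y)) mulrA.
  by apply: ler_wpM2r; [exact: wd_ge0|exact: rC].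
have Ir := int_dom mO mr IC rb.
have Ip := int_scale (- p x) mO I1.
have e1 : Rintegral mu Om (fun y => (v x - v y) * wd w d x y) =
   - p x * Ph w d x - Rintegral mu Om (fun y => r y * wd w d x y).
  rewrite -(lin_wd_left xx) -(RintegralZl (- p x) mO I1) -(RintegralB mO Ip Ir).
  by apply: RI_eq => y _; rewrite /r; ring.
have b1 : `|Rintegral mu Om (fun y => r y * wd w d x y)| <= 2 * C.
  apply: (le_trans (RI_abs_le mO mr IC rb)).
  by rewrite (RintegralZl C mO I2) mulrC ler_wpM2r// sq_wd_RI_le.
(* As [v 0 = 0], the value [r 0] is [p x * x - v x]; hence [v y] equals [p x * y] plus
   [r y - r 0]. *)
pose q y := (r y - r 0) * (Bi d x y)%R%:R.
have IB := int_natb (@Bi_meas R d x Om).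
have r0C : `|r 0| <= C * x ^+ 2.
  by rewrite -[x ^+ 2](_ : (0 - x) ^+ 2 = _); [apply: T1 => //; apply/andP; split; lra|rewrite sub0r sqrrN].
have mq : measurable_fun Om q.
  by apply: measurable_funM; [exact: measurable_funB|exact: Bi_meas].
have qb y : Om y -> `|q y| <= 2 * C * d ^+ 2 * (Bi d x y)%R%:R.
  move=> Oy; rewrite /q /Bi; case: (leP `|y - x| d) => [h|_]; last by rewrite !mulr0 normr0.
  rewrite !mulr1; apply: (le_trans (ler_normB _ _)).
  have h1 : C * (y - x) ^+ 2 <= C * d ^+ 2.
    by apply: ler_wpM2l => //; rewrite -(real_normK (num_real _)) ler_pXn2r ?nnegrE// ltW.
  have h2 : C * x ^+ 2 <= C * d ^+ 2.
    by apply: ler_wpM2l => //; rewrite ler_pXn2r ?nnegrE// ltW.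
  by have := rC y Oy; move: r0C h1 h2; lra.
have Iq : Lint Om q by apply: (int_dom mO mq _ qb); exact: int_scale.
have B2 : Rintegral mu Om (fun y => (Bi d x y)%R%:R) <= 2 * d.
  apply: (@le_trans _ _ (Rintegral mu Om (fun y => (x - d <= y <= x + d)%R%:R))).
    apply: le_Rintegral => //; first by apply: int_natb; exact: itv_ind_meas.
    by move=> y _; rewrite /Bi ler_distl.
  by apply: le_trans (RI_itv_le _) _; lra.
have b2 : `|Rintegral mu Om q| <= 4 * C * d ^+ 3.
  apply: (le_trans (RI_abs_le mO mq (int_scale _ mO IB) qb)).
  rewrite (RintegralZl _ mO IB).
  have c0 : 0 <= 2 * C * d ^+ 2 by rewrite mulr_ge0 ?sqr_ge0// mulr_ge0.
  have := ler_wpM2l c0 B2; move/le_trans; apply.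
  by rewrite le_eqVlt; apply/orP; left; apply/eqP; ring.
pose l (y : T) : R := y * (0 < y < x + d)%R%:R.
have Il : Lint Om l.
  apply: (@int_Om _ _ 1) => [|y Oy]; first by apply: measurable_funM => //; exact: itvo_ind_meas.
  move: Oy; rewrite /Omega /= in_itv/= => /andP[y0 y1].
  rewrite /l normrM -[leRHS]mulr1; apply: ler_pM => //; last exact: natb_le1.
  by rewrite ger0_norm; lra.
have Ipl := int_scale (p x) mO Il.
have e2 : Rintegral mu Om (fun y => v y * (Bi d x y)%R%:R) =
    p x * ((x + d) ^+ 2 / 2) + Rintegral mu Om q.
  rewrite -RI_lin; last by apply/andP; split; lra.
  rewrite -(RintegralZl (p x) mO Il) -(RintegralD mO Ipl Iq).
  have mvB : measurable_fun Om (fun y => v y * (Bi d x y)%R%:R).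
    by apply: measurable_funM => //; exact: Bi_meas.
  apply: RI_eq_ae => //.
    by apply: measurable_funD; [exact: int_meas Ipl|].
  apply: filterS (ae_neq (x + d)) => y yn; rewrite /Omega /= in_itv/= => /andP[y0 y1].
  have -> : Bi d x y = (0 < y < x + d).
    rewrite /Bi ler_distl y0/=; apply/andP/idP => [[h1 h2]|h]; last by split; lra.
    by rewrite lt_neqAle h2 andbT; apply/eqP.
  rewrite /q /l /r v0 /Bi.
  have -> : (`|y - x| <= d) = (0 < y < x + d).
    rewrite ler_distl y0/=; apply/andP/idP => [[h1 h2]|h]; last by split; lra.
    by rewrite lt_neqAle h2 andbT; apply/eqP.
  by ring.
rewrite e1 e2 mulrDr.
have -> : bd w d x * (p x * ((x + d) ^+ 2 / 2)) = p x * Ph w d x.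
  by rewrite bd_left//; field; rewrite gt_eqF// addr_gt0.
have -> : forall a b c : R, - p x * c - a + (p x * c + b) = b - a by move=> *; ring.
apply: (le_trans (ler_normB _ _)); rewrite addrC; apply: lerD => //.
rewrite normrM (ger0_norm (bd_ge0 Hw d0 d1 Ox)).
apply: (@le_trans _ _ (2 * (d ^- 3 * w 0) * (4 * C * d ^+ 3))).
  by apply: ler_pM => //; [exact: bd_ge0|exact: bd_max].
have -> : 2 * (d ^- 3 * w 0) * (4 * C * d ^+ 3) = 8 * C * w 0.
  by field; rewrite gt_eqF.
by [].
Qed.

End Consistency.

End Consist.

(** * Classical solutions for continuous data *)

Section Smooth.
Variable R : realType.
Local Notation mu := (@lebesgue_measure R).
Local Notation Lint D f := (mu.-integrable D (EFin \o f)).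
Local Notation T := (measurableTypeR R).
Local Notation Om := (@Omega R : set T).
Implicit Types (D E : set T).

Lemma cont_int (h : R -> R) (a b : R) : (forall x, a <= x <= b -> {for x, continuous h}) ->
  Lint (`[a, b]%classic : set T) h.
Proof.
move=> ch; apply: continuous_compact_integrable; first exact: segment_compact.
by apply: continuous_in_subspaceT => x /set_mem; rewrite /= in_itv/= => ?; exact: ch.
Qed.

Lemma cont_bnd (h : R -> R) (a b : R) : (forall x, a <= x <= b -> {for x, continuous h}) ->
  exists2 M, 0 <= M & forall x, a <= x <= b -> `|h x| <= M.
Proof.
move=> ch; have cc : compact (h @` `[a, b]%classic).
  apply: continuous_compact; last exact: segment_compact.
  by apply: continuous_in_subspaceT => x /set_mem; rewrite /= in_itv/= => ?; exact: ch.
have [M [_ hM]] := compact_bounded cc.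
exists (`|M| + 1) => // x xx; apply: (hM (`|M| + 1)).
  by apply: (le_lt_trans (ler_norm _)); rewrite ltrDl.
by exists x.
Qed.

Lemma prim_derive (h : R -> R) (a b x : R) : (forall x, a <= x <= b -> {for x, continuous h}) ->
  a < x < b -> is_derive x 1 (fun x => Rintegral mu `[a, x] h) (h x).
Proof.
move=> ch /andP[ax xb]; have Ih := cont_int ch.
have cx : {for x, continuous h} by apply: ch; rewrite !ltW.
have [d1 d2] := continuous_FTC1_closed xb Ih ax cx.
apply: (DeriveDef d1); rewrite -derive1E; exact: d2.
Qed.

Lemma unif_cont (g : R -> R) (e : R) : continuous g -> 0 < e ->
  exists2 eta, 0 < eta & forall x y, 0 <= x <= 1 -> `|x - y| <= eta -> `|g x - g y| <= e.
Proof.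
move=> cg e0.
have /compact_near_coveringP nc := @segment_compact R 0 1.
pose P (eta x : R) := forall y : R, `|x - y| <= eta -> `|g x - g y| <= e.
have H : \forall eta \near (0 : R)^'+, `[0, 1]%classic `<=` P eta.
  apply: nc => x _; have e2 : 0 < e / 2 by rewrite divr_gt0.
  have /cvgrPdist_le /(_ _ e2) := cg x.
  move=> /nbhs_ballP[r /= r0 hr].
  have r2 : 0 < r / 2 by rewrite divr_gt0.
  exists (ball x (r / 2), [set i | i < r / 2]).
    split; first exact: nbhsx_ballx.
    by apply: nbhs_right_lt.
  move=> [x' i] [/= bx ir] y yi.
  have b1 : ball x r x' by move: bx; rewrite /ball /=; lra.
  have b2 : ball x r y.
    move: bx; rewrite /ball /= => bx.
    have -> : x - y = (x - x') + (x' - y) by ring.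
    by apply: (le_lt_trans (ler_normD _ _)); lra.
  have := hr _ b1; have := hr _ b2; rewrite /= => h1 h2.
  have -> : g x' - g y = - (g x - g x') + (g x - g y) by ring.
  by apply: (le_trans (ler_normD _ _)); rewrite normrN; lra.
have [eta [eta0 He]] : exists eta : R, 0 < eta /\ `[0, 1]%classic `<=` P eta.
  have [eta [h1 h2]] := filter_ex (filterI (nbhs_right_gt (0 : R)) H).
  by exists eta.
exists eta => // x y xx; apply: He.
by rewrite /= in_itv.
Qed.

Lemma mvt01 (f df : R -> R) (x y : R) :
  (forall z : R, 0 <= z <= 1 -> is_derive z 1 f (df z)) -> 0 <= x <= 1 -> 0 <= y <= 1 ->
  exists z : R, [/\ 0 <= z <= 1, `|z - x| <= `|y - x| & f y - f x = df z * (y - x)].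
Proof.
move=> fd.
have main (a b : R) : 0 <= a -> a <= b -> b <= 1 -> exists2 c : R, a <= c <= b & f b - f a = df c * (b - a).
  move=> a0 ab b1.
  have fd' (c : R) : c \in `]a, b[%R -> is_derive c 1 f (df c).
    by rewrite in_itv/= => /andP[h1 h2]; apply: fd; apply/andP; split; lra.
  have fc : {within `[a, b], continuous f}.
    apply: derivable_within_continuous => c; rewrite in_itv/= => /andP[h1 h2].
    apply: (@ex_derive _ _ _ _ _ _ (df c)); apply: fd.
    by apply/andP; split; lra.
  have [c] := MVT_segment ab fd' fc.
  by rewrite in_itv/= => h1 h2; exists c.
move=> /andP[x0 x1] /andP[y0 y1]; have [xy|yx] := leP x y.
  have [c /andP[c1 c2] ec] := main _ _ x0 xy y1; exists c; split => //.
  - by apply/andP; split; lra.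
  - by rewrite !ger0_norm; lra.
have [c /andP[c1 c2] ec] := main _ _ y0 (ltW yx) x1; exists c; split => //.
- by apply/andP; split; lra.
- by rewrite !ler0_norm; lra.
- by rewrite -opprB ec; ring.
Qed.

(** Two successive primitives. They start at -2 and -1, so that two-sided derivatives exist at both
    end points of [[0, 1]]; [shift] moves the base points back to 0. *)
Lemma smooth_sol (g : R -> R) : continuous g -> exists v p : R -> R,
  [/\ [/\ v 0 = 0, v 1 = 0, Lint Om p & Rintegral mu Om p = 0],
      forall x : R, 0 <= x <= 1 -> is_derive x 1 v (p x),
      forall x : R, 0 <= x <= 1 -> is_derive x 1 p (- g x),
      forall x : R, 0 <= x <= 1 -> v x = Rintegral mu `[0, x] p &
      forall x : R, 0 <= x <= 1 -> p x = p 0 - Rintegral mu `[0, x] g].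
Proof.
move=> cg; have mO := @mOm R.
have shift (h : R -> R) (a x : R) : (forall x : R, a <= x <= 3 / 2 -> {for x, continuous h}) ->
    a < 0 -> 0 <= x <= 1 ->
    Rintegral mu `[a, x] h - Rintegral mu `[a, 0] h = Rintegral mu `[0, x] h.
  move=> ch a0 /andP[x0 x1].
  have Iax : Lint (`[a, x]%classic : set T) h.
    by apply: cont_int => y /andP[y0 y1]; apply: ch; apply/andP; split; lra.
  have I0x : Lint (`]0, x]%classic : set T) h.
    apply: integrableS Iax => // y /=; rewrite !in_itv/= => /andP[y0 y1].
    by apply/andP; split; lra.
  rewrite -(Rintegral_itv_obnd_cbnd I0x).
  by apply: Rintegral_itvB => //; rewrite bnd_simp; lra.
pose P0 (t : R) := Rintegral mu `[(-2 : R), t] g.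
have dP0 (x : R) : -2 < x < 2 -> is_derive x 1 P0 (g x).
  by move=> xx; apply: (@prim_derive g (-2) 2) => // y _; exact: cg.
(* The constant of integration that gives [p] mean zero, hence [v 1 = 0]. *)
pose kappa := Rintegral mu Om P0.
pose p (t : R) := kappa - P0 t.
have dp (x : R) : -2 < x < 2 -> is_derive x 1 p (- g x).
  move=> xx; rewrite -[X in is_derive _ _ _ X]sub0r; apply: is_deriveB; exact: dP0.
have dcont (h dh : R -> R) (x : R) : is_derive x 1 h (dh x) -> {for x, continuous h}.
  move=> H; apply: differentiable_continuous; apply/derivable1_diffP.
  by have [] := H.
have cP0 (x : R) : 0 <= x <= 1 -> {for x, continuous P0}.
  by move=> /andP[h1 h2]; apply: (dcont _ g); apply: dP0; apply/andP; split; lra.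
have cp (x : R) : -1 <= x <= 3 / 2 -> {for x, continuous p}.
  by move=> /andP[h1 h2]; apply: (dcont _ (fun x => - g x)); apply: dp; apply/andP; split; lra.
have cp0 (x : R) : 0 <= x <= 1 -> {for x, continuous p}.
  by move=> /andP[h1 h2]; apply: cp; apply/andP; split; lra.
have Ip01 := cont_int cp0.
have OmS : Om `<=` `[0, 1]%classic.
  by move=> y; rewrite /Omega /= !in_itv/= => /andP[h1 h2]; apply/andP; split; lra.
have IpO : Lint Om p by apply: integrableS Ip01.
have IP0 : Lint Om P0 by apply: integrableS (cont_int cP0).
have Rp : Rintegral mu Om p = 0.
  rewrite RintegralB// ?RI_cst_Omega ?subrr//.
  by apply: (@int_Om R _ `|kappa|).
pose V (t : R) := Rintegral mu `[(-1 : R), t] p.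
have dV (x : R) : 0 <= x <= 1 -> is_derive x 1 V (p x).
  move=> /andP[h1 h2]; apply: (@prim_derive p (-1) (3 / 2)) => //.
  by apply/andP; split; lra.
have vE (x : R) : 0 <= x <= 1 -> V x - V 0 = Rintegral mu `[0, x] p.
  by move=> xx; apply: shift => //; lra.
exists (fun t => V t - V 0), p; split.
- split => //; first by rewrite subrr.
  rewrite vE; last by apply/andP; split; lra.
  transitivity (Rintegral mu Om p) => //; rewrite /Omega Rintegral_itv_bndo_bndc//.
  rewrite Rintegral_itv_obnd_cbnd//; apply: integrableS Ip01 => //.
  by move=> y; rewrite /= !in_itv/= => /andP[h1 h2]; apply/andP; split; lra.
- move=> x xx; rewrite -[X in is_derive _ _ _ X]subr0; apply: is_deriveB; exact: dV.
- by move=> x /andP[h1 h2]; apply: dp; apply/andP; split; lra.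
- exact: vE.
- move=> x xx; have := @shift g (-2) x (fun y _ => cg y) ltac:(lra) xx.
  by rewrite -/(P0 x) -/(P0 0) => <-; rewrite /p; ring.
Qed.
End Smooth.

(** * The limit problem and density *)

Section Elliptic.
Variable R : realType.
Local Notation mu := (@lebesgue_measure R).
Local Notation Lint D f := (mu.-integrable D (EFin \o f)).
Local Notation T := (measurableTypeR R).
Local Notation Om := (@Omega R : set T).
Implicit Types (D E : set T) (f g h : T -> R).
Let mO := @mOm R.

Lemma L2P (f : R -> R) : L2 f <-> measurable_fun Om f /\ Lint Om (fun x => f x ^+ 2).
Proof.
split=> -[mf]; last first.
  move=> If; split => //; have := integrable_lty mO If.
  by [].
move=> If; split => //; apply/integrableP; split.
  by apply/measurable_EFinP; exact: measurable_funX.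
rewrite (eq_integral (fun x : T => (f x ^+ 2)%:E)) //.
by move=> x _ /=; rewrite ger0_norm ?sqr_ge0.
Qed.

Lemma L2_Lint (f : R -> R) : L2 f -> Lint Om f.
Proof. by move=> /L2P[mf If]; exact: L2_int. Qed.

Lemma L2_mul (f g : R -> R) : L2 f -> L2 g -> Lint Om (fun x => f x * g x).
Proof.
move=> /L2P[mf If] /L2P[mg Ig].
apply: (@int_dom R Om _ (fun x => f x ^+ 2 + g x ^+ 2)) => //.
- exact: measurable_funM.
- exact: int_add.
- move=> x _; have h1 := sqr_ge0 (f x - g x); have h2 := sqr_ge0 (f x + g x).
  have h3 := sqr_ge0 (f x); have h4 := sqr_ge0 (g x).
  by rewrite ler_norml; apply/andP; split; nra.
Qed.

Lemma L2_sub (f g : R -> R) : L2 f -> L2 g -> L2 (fun x => f x - g x).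
Proof.
move=> Lf Lg; have Ifg := L2_mul Lf Lg; move: Lf Lg => /L2P[mf If] /L2P[mg Ig].
apply/L2P; split; first exact: measurable_funB.
have I1 := int_add mO If Ig; have I2 := int_scale 2 mO Ifg.
apply: (@eq_int R Om (fun x => f x ^+ 2 + g x ^+ 2 - 2 * (f x * g x))) => //.
  by move=> x _; ring.
exact: int_sub.
Qed.

Lemma L2_bnd (f : R -> R) C : measurable_fun Om f -> (forall x, Om x -> `|f x| <= C) -> L2 f.
Proof.
move=> mf fC; apply/L2P; split => //.
apply: (@int_Om R _ (C ^+ 2)) => [|x Ox]; first exact: measurable_funX.
rewrite normrX; have := fC x Ox => h; rewrite ler_pXn2r ?nnegrE//.
exact: le_trans h.
Qed.

Let ind_le_meas (x : R) : measurable_fun Om (fun t : T => (t <= x)%R%:R : R).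
Proof. exact: meas_le_ind. Qed.

Let ind_ge_meas (x : R) : measurable_fun Om (fun t : T => (x <= t)%R%:R : R).
Proof. exact: meas_le_ind. Qed.

(** Writing a primitive as an integral over all of [Om] with a triangular indicator puts repeated
    integrals on the unit square, where [fubini_dom] applies. *)
Lemma cumE (f : R -> R) (x : R) : Lint Om f -> Om x ->
  Rintegral mu `[0, x] f = Rintegral mu Om (fun t => (t <= x)%R%:R * f t).
Proof.
move=> If; rewrite /Omega /= in_itv/= => /andP[x0 x1].
have S : `]0, x]%classic `<=` Om.
  by move=> y; rewrite /Omega /= !in_itv/= => /andP[h1 h2]; apply/andP; split; lra.
rewrite -Rintegral_itv_obnd_cbnd; last by apply: integrableS If.
rewrite -(@RI_restr R `]0, x]%classic Om) //.
  by apply: RI_eq => t /=; rewrite in_itv/= => /andP[_ ->]; rewrite mul1r.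
move=> y; rewrite /Omega /= !in_itv/= => /andP[-> _] /negP/negbTE /= ->.
by rewrite mul0r.
Qed.

Lemma cum_int (f : R -> R) (x : R) : Lint Om f -> Lint Om (fun t => (t <= x)%R%:R * f t).
Proof. by move=> If; apply: (int_mulb (C := 1) mO If) => // t _; exact: natb_le1. Qed.

Lemma cum_int' (f : R -> R) (x : R) : Lint Om f -> Lint Om (fun t => (x <= t)%R%:R * f t).
Proof. by move=> If; apply: (int_mulb (C := 1) mO If) => // t _; exact: natb_le1. Qed.

Lemma cum_compl (f : R -> R) (t : R) : Lint Om f -> Om t ->
  Rintegral mu Om (fun x => (t <= x)%R%:R * f x) = Rintegral mu Om f - Rintegral mu `[0, t] f.
Proof.
move=> If Ot; rewrite cumE//.
apply: (addIr (Rintegral mu Om (fun x => (x <= t)%R%:R * f x))); rewrite subrK.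
rewrite -(RintegralD mO (cum_int' t If) (cum_int t If)).
apply: RI_eq_ae => //.
- exact: int_meas (int_add mO (cum_int' t If) (cum_int t If)).
- exact: int_meas If.
- apply: filterS (ae_neq t) => x xt _; rewrite -mulrDl.
  by have [h|h|h] := ltgtP x t; rewrite /= ?add0r ?addr0 ?mul1r//; case: xt.
Qed.

(** [Om] has measure one, so this is nonnegativity of the variance of the absolute value of [h]. *)
Lemma cauchy_schwarz1 (h : R -> R) : L2 h ->
  (Rintegral mu Om (fun x => `|h x|)) ^+ 2 <= Rintegral mu Om (fun x => h x ^+ 2).
Proof.
move=> Lh; have /L2P[mh Ih2] := Lh; have Ih := int_abs (L2_Lint Lh).
set m := Rintegral _ _ _.
have : 0 <= Rintegral mu Om (fun x => (`|h x| - m) ^+ 2).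
  by apply: Rintegral_ge0 => x _; exact: sqr_ge0.
have I1 := int_scale (- (2 * m)) mO Ih.
have Ic : Lint Om (cst (m ^+ 2)) by apply: (@int_Om R _ `|m ^+ 2|).
have -> : Rintegral mu Om (fun x => (`|h x| - m) ^+ 2) =
    Rintegral mu Om (fun x => h x ^+ 2) + - (2 * m) * m + m ^+ 2.
  have ez : Rintegral mu Om (fun x => - (2 * m) * `|h x|) = - (2 * m) * m.
    exact: (RintegralZl (- (2 * m)) mO Ih).
  rewrite -ez -(RintegralD mO Ih2 I1) -[X in _ + X](RI_cst_Omega (m ^+ 2)).
  rewrite -(RintegralD mO (int_add mO Ih2 I1) Ic); apply: RI_eq => x _.
  by rewrite -(real_normK (num_real (h x))) /cst; ring.
by move: (Rintegral mu Om (fun x => h x ^+ 2)) => H; nra.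
Qed.

Let half_absorb (P H D : R) : P <= H -> H <= 2^-1 * D + 2^-1 * P -> P <= D.
Proof. lra. Qed.

Section Elliptic.
Variables (g v p : R -> R).
Hypothesis cg : continuous g.
Hypotheses (Ip : Lint Om p) (mv : measurable_fun Om v) (Lv : L2 v) (Lp : L2 p) (Lg : L2 g).
Hypothesis Rp : Rintegral mu Om p = 0.
Hypothesis vE : forall x : R, 0 <= x <= 1 -> v x = Rintegral mu `[0, x] p.
Hypothesis pE : forall x : R, 0 <= x <= 1 -> p x = p 0 - Rintegral mu `[0, x] g.

Let OmI (x : R) : Om x -> 0 <= x <= 1.
Proof. by rewrite /Omega /= in_itv/= => /andP[h1 h2]; rewrite !ltW. Qed.

(** Integration by parts, carried out as Fubini on the triangle [t <= x] because [phi] is a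
    primitive of [h] only almost everywhere. The boundary terms vanish since [h] has mean zero. *)
Lemma weak_smooth (phi h : R -> R) : H10_with_deriv phi h ->
  Rintegral mu Om (fun x => p x * h x) = Rintegral mu Om (fun x => g x * phi x).
Proof.
move=> [Lphi [Lh [Rh phiE]]]; have Ih := L2_Lint Lh.
have [M M0 gM] : exists2 M, 0 <= M & forall x : R, 0 <= x <= 1 -> `|g x| <= M.
  by apply: cont_bnd => x _; exact: cg.
have Ig := L2_Lint Lg; have mg := int_meas Ig; have mh := int_meas Ih.
pose F (x t : R) := (t <= x)%R%:R * (g t * h x).
have m1 : measurable_fun (Om `*` Om) (fun z : T * T => z.1).
  by apply: measurable_funTS; exact: measurable_fst.
have m2 : measurable_fun (Om `*` Om) (fun z : T * T => z.2).
  by apply: measurable_funTS; exact: measurable_snd.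
have mF : measurable_fun (Om `*` Om) (fun z : T * T => F z.1 z.2).
  apply: measurable_funM; first exact: meas_le_ind.
  by apply: measurable_funM; [exact: meas_snd|exact: meas_fst].
have IM := int_scale M mO (int_abs Ih).
have FM x y : Om x -> Om y -> `|F x y| <= M * `|h x| + M * `|h y|.
  move=> Ox Oy; rewrite /F !normrM.
  apply: (@le_trans _ _ (M * `|h x|)); last by rewrite lerDl mulr_ge0.
  rewrite -[leRHS]mul1r; apply: ler_pM; [exact: normr_ge0|exact: mulr_ge0|exact: natb_le1|].
  by apply: ler_wpM2r => //; apply: gM; exact: OmI.
have Fub := fubini_dom mF IM FM.
have IFx : Lint Om (fun x => Rintegral mu Om (F x)) := dom_int_RI mF IM FM.
have e1 x : Om x -> p x * h x = p 0 * h x - Rintegral mu Om (F x).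
  move=> Ox; rewrite (pE (OmI Ox)) (cumE Ig Ox) mulrBl; congr (_ - _).
  rewrite mulrC -(RintegralZl (h x) mO (cum_int x Ig)).
  by apply: RI_eq => t _; rewrite /F; ring.
have e2 t : Om t -> Rintegral mu Om (fun x => F x t) = - (g t * Rintegral mu `[0, t] h).
  move=> Ot; have := cum_compl Ih Ot; rewrite Rh sub0r => e.
  rewrite -mulrN -e -(RintegralZl (g t) mO (cum_int' t Ih)).
  by apply: RI_eq => x _; rewrite /F; ring.
rewrite (RI_eq e1) (RintegralB mO (int_scale (p 0) mO Ih) IFx) (RintegralZl (p 0) mO Ih) Rh mulr0 sub0r.
have {}Fub : Rintegral mu Om (fun x => Rintegral mu Om (F x)) =
  Rintegral mu Om (fun t => Rintegral mu Om (fun x => F x t)) := Fub.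
rewrite Fub.
have Igp := L2_mul Lg Lphi.
rewrite (@RI_eq_ae R Om _ (fun t => -1 * (g t * phi t))).
- by rewrite (RintegralZl (-1) mO Igp); ring.
- exact: mO.
- apply: int_meas; apply: (dom_int_RI (F := fun t x => F x t) (meas_swap mF) IM).
  by move=> x y Ox Oy; rewrite addrC; exact: FM.
- exact: int_meas (int_scale (-1) mO Igp).
- have phiE' : {ae mu, forall x : T, Om x -> phi x = Rintegral mu `[0, x] h} := phiE.
  by apply: filterS phiE' => t et Ot; rewrite e2// -et// mulN1r.
Qed.

(** The difference of the two weak formulations is tested with [phi = u0 - v] itself. Cauchy-Schwarz
    applied to the primitive gives the Poincare inequality with constant 1, and Young's inequality
    leaves a half of the norm of [phi] to be absorbed. *)
Lemma elliptic (f u0 : R -> R) : L2 f -> weak_solution f u0 ->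
  L2 u0 /\
  Rintegral mu Om (fun x => (u0 x - v x) ^+ 2) <= Rintegral mu Om (fun x => (f x - g x) ^+ 2).
Proof.
move=> Lf [g0 [[Lu [Lg0 [Rg0 u0E]]] W]]; split => //.
have Lh := L2_sub Lg0 Lp; have Lphi := L2_sub Lu Lv; have Lfg := L2_sub Lf Lg.
set h := (fun x => g0 x - p x) in Lh; set phi := (fun x => u0 x - v x) in Lphi.
have Ig0 := L2_Lint Lg0; have Ih := L2_Lint Lh.
have phiE x : Om x -> u0 x = Rintegral mu `[0, x] g0 -> phi x = Rintegral mu `[0, x] h.
  move=> Ox e; rewrite /phi e (vE (OmI Ox)) !cumE//.
  rewrite -(RintegralB mO (cum_int x Ig0) (cum_int x Ip)).
  by apply: RI_eq => t _; rewrite /h mulrBr.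
have H10 : H10_with_deriv phi h.
  do 3 (split; first by rewrite // /h RintegralB// Rg0 Rp subrr).
  have u0E' : {ae mu, forall x : T, Om x -> u0 x = Rintegral mu `[0, x] g0} := u0E.
  have : {ae mu, forall x : T, Om x -> phi x = Rintegral mu `[0, x] h}.
    by apply: filterS u0E' => x e Ox; apply: phiE => //; exact: e.
  by [].
have w1 := W _ _ H10; have w2 := weak_smooth H10.
set H := Rintegral mu Om (fun x => h x ^+ 2).
set D := Rintegral mu Om (fun x => (f x - g x) ^+ 2).
have /L2P[mphi Iphi2] := Lphi; have /L2P[mfg Ifg2] := Lfg; have /L2P[mh Ih2] := Lh.
have HE : H = Rintegral mu Om (fun x => (f x - g x) * phi x).
  transitivity (Rintegral mu Om (fun x => f x * phi x) - Rintegral mu Om (fun x => g x * phi x)).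
    rewrite -w1 -w2 -(RintegralB mO (L2_mul Lg0 Lh) (L2_mul Lp Lh)).
    by apply: RI_eq => x _; rewrite -mulrBl expr2.
  rewrite -(RintegralB mO (L2_mul Lf Lphi) (L2_mul Lg Lphi)).
  by apply: RI_eq => x _; rewrite mulrBl.
have phiH : Rintegral mu Om (fun x => phi x ^+ 2) <= H.
  rewrite -(RI_cst_Omega H); apply: RI_le_ae => //; first by apply: (@int_Om R _ `|H|).
  have u0E' : {ae mu, forall x : T, Om x -> u0 x = Rintegral mu `[0, x] g0} := u0E.
  apply: filterS u0E' => x e Ox; rewrite (phiE x Ox (e Ox)) (cumE Ih Ox).
  apply: (le_trans _ (cauchy_schwarz1 Lh)).
  rewrite -(real_normK (num_real _)) ler_pXn2r ?nnegrE//; last by apply: Rintegral_ge0.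
  apply: (RI_abs_le mO) => //; [exact: int_meas (cum_int x Ih)|exact: int_abs|].
  by move=> t _; rewrite normrM -[leRHS]mul1r; apply: ler_wpM2r => //; exact: natb_le1.
have HD : H <= 2^-1 * D + 2^-1 * Rintegral mu Om (fun x => phi x ^+ 2).
  rewrite HE -(RintegralZl 2^-1 mO Ifg2) -(RintegralZl 2^-1 mO Iphi2).
  have I1 := int_scale 2^-1 mO Ifg2; have I2 := int_scale 2^-1 mO Iphi2.
  rewrite -(RintegralD mO I1 I2); apply: le_Rintegral => //.
  - exact: L2_mul.
  - exact: int_add.
  - move=> x _; have := sqr_ge0 (f x - g x - phi x).
    by move: (f x - g x) (phi x) => a b; nra.
exact: (half_absorb phiH HD).
Qed.

End Elliptic.

End Elliptic.

(** * Density of continuous functions in [L2] *)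

Section Density.
Variable R : realType.
Local Notation mu := (@lebesgue_measure R).
Local Notation Lint D f := (mu.-integrable D (EFin \o f)).
Local Notation T := (measurableTypeR R).
Local Notation Om := (@Omega R : set T).
Implicit Types (D E : set T).
Let mO := @mOm R.

Definition clip (M x : R) : R := Num.max (- M) (Num.min x M).

Lemma clip_cases M x : 0 <= M -> [\/ x <= - M /\ clip M x = - M, M <= x /\ clip M x = M |
  [/\ - M <= x, x <= M & clip M x = x]].
Proof.
move=> M0; rewrite /clip; have [xM|Mx] := leP x M; last first.
  by constructor 2; split; [exact: ltW|rewrite max_r//; lra].
by have [Mx|xM'] := leP (- M) x; [constructor 3|constructor 1; split => //; exact: ltW].
Qed.

Lemma clip_le M x : 0 <= M -> `|clip M x| <= M.
Proof.
move=> M0; rewrite ler_norml.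
by case: (clip_cases x M0) => [[h1 ->]|[h1 ->]|[h1 h2 ->]]; apply/andP; split; lra.
Qed.

Lemma clip_id M x : 0 <= M -> `|x| <= M -> clip M x = x.
Proof.
move=> M0; rewrite ler_norml => /andP[h1 h2].
by rewrite /clip min_l// max_r.
Qed.

Lemma clip_lip M x y : 0 <= M -> `|clip M x - clip M y| <= `|x - y|.
Proof.
move=> M0; have h := ler_norm (x - y); have h' := ler_norm (y - x); rewrite distrC in h'.
rewrite ler_norml; have h0 := normr_ge0 (x - y).
by case: (clip_cases x M0) => [[h1 ->]|[h1 ->]|[h1 h2 ->]];
   case: (clip_cases y M0) => [[g1 ->]|[g1 ->]|[g1 g2 ->]]; apply/andP; split; lra.
Qed.

Lemma clip_rest M x : 0 <= M -> (x - clip M x) ^+ 2 <= x ^+ 2.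
Proof.
by move=> M0; case: (clip_cases x M0) => [[h1 ->]|[h1 ->]|[h1 h2 ->]]; nra.
Qed.

Lemma clip_cont M (g : R -> R) : continuous g -> continuous (fun x => clip M (g x)).
Proof.
move=> cg x.
have : {for x, continuous ((cst (- M) : R -> R^o) \max ((g : R -> R^o) \min cst M))}.
  apply: continuous_max; first exact: cvg_cst.
  by apply: continuous_min; [exact: cg|exact: cvg_cst].
by [].
Qed.

Lemma clip_meas M (g : T -> R) D : measurable_fun D g -> measurable_fun D (fun x => clip M (g x)).
Proof. by move=> mg; apply: measurable_maxr => //; exact: measurable_minr. Qed.

Lemma ecvg0_ex (X : nat -> \bar R) (e : R) : 0 < e -> X @ \oo --> 0%E -> exists n, fine (X n) <= e.
Proof.
move=> e0 /fine_cvgP[_ /cvgrPdist_le /(_ _ e0) H].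
have [n _ hn] := H; exists n; have := hn n (leqnn n).
by rewrite /= sub0r normrN => h; apply: (le_trans (ler_norm _)).
Qed.

(** At each point the truncations at level [n] are eventually equal to [f], and the squared error is
    dominated by [f ^+ 2]. *)
Lemma trunc_dense (f : R -> R) (e : R) : L2 f -> 0 < e -> exists M, 0 <= M /\
  Rintegral mu Om (fun x => (f x - clip M (f x)) ^+ 2) <= e.
Proof.
move=> /L2P[mf If] e0.
pose F (n : nat) (x : T) : \bar R := ((f x - clip n%:R (f x)) ^+ 2)%:E.
have mF n : measurable_fun Om (F n).
  apply/measurable_EFinP; apply: measurable_funX; apply: measurable_funB => //.
  exact: clip_meas.
have cF : {ae mu, forall x, Om x -> F ^~ x @ \oo --> (cst 0%E : T -> \bar R) x}.
  apply: aeW => x Ox; apply: cvg_near_cst.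
  apply: filterS (nbhs_infty_ger `|f x|) => n hn.
  by rewrite /F clip_id ?subrr ?expr0n.
have dF : {ae mu, forall x n, Om x -> (`|F n x| <= (f x ^+ 2)%:E)%E}.
  by apply: aeW => x n Ox; rewrite /F /= lee_fin ger0_norm ?sqr_ge0//; exact: clip_rest.
have [_ _ H] := dominated_convergence mO mF (measurable_cst _) cF If dF.
rewrite integral0 in H.
have [n hn] := ecvg0_ex e0 H.
by exists n%:R; split.
Qed.

(** Continuous functions are dense in [L1]. Once [f] and its approximant are both cut off at [M],
    the squared difference is at most [2 * M] times its absolute value, and cutting off is
    1-Lipschitz, so it does not increase the [L1] distance. *)
Lemma cont_dense (f : R -> R) (e : R) : L2 f -> 0 < e -> exists2 g : R -> R, continuous g &
  Rintegral mu Om (fun x => (f x - g x) ^+ 2) <= e.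
Proof.
move=> Lf e0; have e4 : 0 < e / 4 by rewrite divr_gt0.
have [M [M0 hM]] := trunc_dense Lf e4.
have [mf If] := (L2P f).1 Lf.
pose fM x := clip M (f x).
have mfM : measurable_fun Om fM by exact: clip_meas.
have LfM : L2 fM by apply: (@L2_bnd R _ M) => // x _; exact: clip_le.
have IfM := L2_Lint LfM.
have Ofin : (mu Om < +oo)%E by rewrite mu_Omega ltry.
have [g_ [cg Ig H]] := approximation_continuous_integrable mO Ofin IfM.
(* Multiplied by [4 * M] this stays below [e / 2]; the summand 1 excludes division by zero. *)
have eM : 0 < e / (8 * (M + 1)) by rewrite divr_gt0// mulr_gt0//; lra.
have [n hn] := ecvg0_ex eM H.
pose g x := clip M (g_ n x).
have cgn : continuous g by apply: clip_cont; exact: cg.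
have mgn : measurable_fun Om (g_ n) by exact: int_meas (Ig n).
have mg : measurable_fun Om g by exact: clip_meas.
have Lg : L2 g by apply: (@L2_bnd R _ M) => // x _; exact: clip_le.
exists g => //.
have I1 : Lint Om (fun x => `|fM x - g_ n x|) by apply: int_abs; exact: int_sub.
have hn' : Rintegral mu Om (fun x => `|fM x - g_ n x|) <= e / (8 * (M + 1)) by exact: hn.
have /L2P[_ Ia] := L2_sub Lf LfM.
have /L2P[_ Ib] := L2_sub Lf Lg.
have J1 := int_scale 2 mO Ia; have J2 := int_scale (4 * M) mO I1.
have : Rintegral mu Om (fun x => (f x - g x) ^+ 2) <=
    Rintegral mu Om (fun x => 2 * (f x - fM x) ^+ 2 + 4 * M * `|fM x - g_ n x|).
  apply: le_Rintegral => //; first exact: int_add.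
  move=> x _.
  have h1 : `|fM x - g x| <= `|fM x - g_ n x|.
    rewrite -[X in `|X - _|](@clip_id M) //; last exact: clip_le.
    exact: clip_lip.
  have h2 : `|fM x - g x| <= 2 * M.
    apply: (le_trans (ler_normB _ _)); have := clip_le (f x) M0; have := clip_le (g_ n x) M0.
    by rewrite /fM /g; lra.
  have h3 : (fM x - g x) ^+ 2 <= 2 * M * `|fM x - g_ n x|.
    by rewrite -(real_normK (num_real _)) expr2; apply: ler_pM.
  have h4 := sqr_ge0 ((f x - fM x) - (fM x - g x)).
  move: h3 h4; move: (`|fM x - g_ n x|) (f x) (fM x) (g x) => r a b c; nra.
rewrite (RintegralD mO J1 J2) (RintegralZl 2 mO Ia) (RintegralZl (4 * M) mO I1) => h.
apply: (le_trans h).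
have M1 : 0 <= 4 * M by lra.
have h5 := ler_wpM2l M1 hn'.
have h6 : 4 * M * (e / (8 * (M + 1))) <= e / 2.
  have -> : e / 2 = 4 * (M + 1) * (e / (8 * (M + 1))) by field; lra.
  by apply: ler_wpM2r; [exact: ltW|lra].
move: hM h5 h6; rewrite -/fM; move: (Rintegral mu Om _) (Rintegral mu Om _) => a b; lra.
Qed.
End Density.

(** * Taylor estimates and the error bound for a fixed [d] *)

Section Main.
Variable R : realType.
Local Notation mu := (@lebesgue_measure R).
Local Notation Lint D f := (mu.-integrable D (EFin \o f)).
Local Notation T := (measurableTypeR R).
Local Notation Om := (@Omega R : set T).
Implicit Types (D E : set T).
Let mO := @mOm R.

Section Taylor.
Variables (v p g : R -> R).
Hypothesis dv : forall x : R, 0 <= x <= 1 -> is_derive x 1 v (p x).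
Hypothesis dp : forall x : R, 0 <= x <= 1 -> is_derive x 1 p (- g x).

Lemma taylor1 (G x y : R) : (forall x, 0 <= x <= 1 -> `|g x| <= G) ->
  0 <= x <= 1 -> 0 <= y <= 1 ->
  `|v y - v x - p x * (y - x)| <= G * (y - x) ^+ 2.
Proof.
move=> gG xx yy.
have [z [zz zx ->]] := mvt01 dv xx yy.
have [s [ss sx e]] := mvt01 dp xx zz.
rewrite -mulrBl e -(real_normK (num_real (y - x))) expr2 mulrA !normrM normrN.
apply: ler_wpM2r => //; apply: ler_pM => //; exact: gG.
Qed.

Lemma taylor_aux (x t : R) : 0 <= t <= 1 ->
  is_derive t 1 (fun t : R => v t - p x * t + g x / 2 * (t - x) ^+ 2)
     (p t - p x + g x * (t - x)).
Proof.
move=> tt; have dvt := dv tt.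
rewrite (_ : (fun t : R => _) =
  (v : R -> R) - (p x) \*: (id : R -> R) + (g x / 2) \*: ((id - cst x : R -> R) ^+ 2)); last first.
  by apply/funext => s; rewrite !fctE.
have hid : is_derive t 1 (id : R -> R) 1 by exact: is_derive_id.
have hc : is_derive t 1 (cst x : R -> R) 0 by exact: is_derive_cst.
have hs := is_deriveX 2 (is_deriveB hid hc).
have h := is_deriveD (is_deriveB dvt (is_deriveZ (p x) hid)) (is_deriveZ (g x / 2) hs).
have -> : p t - p x + g x * (t - x) =
    p t - p x *: 1 + (g x / 2) *: ((2%:R * (id - cst x : R -> R) t ^+ 2.-1) *: (1 - 0)).
  by rewrite !fctE /= /GRing.scale /=; field.
exact: h.
Qed.

(** The mean value theorem, applied to [v] minus its quadratic Taylor polynomial and then to [p],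
    leaves [(g x - g s) * (z - x) * (y - x)] with [z] and [s] no further from [x] than [y]; the
    modulus of continuity of [g] bounds this. *)
Lemma taylor2 (e eta x y : R) :
  (forall x y, 0 <= x <= 1 -> `|x - y| <= eta -> `|g x - g y| <= e) ->
  0 <= x <= 1 -> 0 <= y <= 1 -> `|y - x| <= eta ->
  `|v y - v x - p x * (y - x) + g x / 2 * (y - x) ^+ 2| <= e * (y - x) ^+ 2.
Proof.
move=> ge xx yy yx.
have [z [zz zx E]] := mvt01 (taylor_aux x) xx yy.
have [s [ss sx e1]] := mvt01 dp xx zz.
have -> : v y - v x - p x * (y - x) + g x / 2 * (y - x) ^+ 2 =
   v y - p x * y + g x / 2 * (y - x) ^+ 2 - (v x - p x * x + g x / 2 * (x - x) ^+ 2) by ring.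
rewrite E e1.
have -> : (- g s * (z - x) + g x * (z - x)) * (y - x) = (g x - g s) * (z - x) * (y - x) by ring.
rewrite -(real_normK (num_real (y - x))) expr2 mulrA !normrM.
apply: ler_wpM2r => //; apply: ler_pM => //; apply: ge => //.
by rewrite distrC; apply: (le_trans sx); apply: (le_trans zx).
Qed.
End Taylor.

Variable w : R -> R.
Hypothesis Hw : A1 w.

Section OneStep.
Variable d : R.
Hypotheses (d0 : 0 < d) (d1 : d < 2^-1).
Hypotheses (H2 : A2s w d) (H3 : A3 w d).
Hypothesis d2 : w (1 / 2) * d / 128 + coer w * d ^+ 2 <= 3 / 4 * (7 / 256 * w (15 / 16)).

Variables (v p g : R -> R) (G e eta : R).
Hypothesis dv : forall x : R, 0 <= x <= 1 -> is_derive x 1 v (p x).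
Hypothesis dp : forall x : R, 0 <= x <= 1 -> is_derive x 1 p (- g x).
Hypotheses (v0 : v 0 = 0) (v1 : v 1 = 0).
Hypothesis gG : forall x : R, 0 <= x <= 1 -> `|g x| <= G.
Hypothesis ge : forall x y : R, 0 <= x <= 1 -> `|x - y| <= eta -> `|g x - g y| <= e.
Hypothesis deta : d <= eta.
Hypothesis Lv : L2 v.

Let Iv : Lint Om v. Proof. exact: L2_Lint. Qed.
Let mv : measurable_fun Om v. Proof. exact: int_meas Iv. Qed.
Let OmI (x : R) : Om x -> 0 <= x <= 1.
Proof. by rewrite /Omega /= in_itv/= => /andP[h1 h2]; rewrite !ltW. Qed.
Let G0 : 0 <= G.
Proof. by apply: (le_trans (normr_ge0 (g 0))); apply: gG; rewrite lexx ler01. Qed.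

(** Bound on the layers for [g] and [Nd v] together, from [cons_left] with [C = G]. *)
Let C1 := G + (2 * G + 8 * G * w 0).

Let interior (x : R) : Om x -> d <= x <= 1 - d -> `|Nd w d v x - g x| <= 2 * e.
Proof.
move=> Ox xx; apply: (cons_interior (p := p) Hw d0 d1 mv Iv xx Ox) => y Oy yx.
by apply: (taylor2 dv dp ge (OmI Ox) (OmI Oy)); exact: le_trans deta.
Qed.

Let left_layer (x : R) : Om x -> x < d -> `|Nd w d v x| <= 2 * G + 8 * G * w 0.
Proof.
move=> Ox xd; apply: (cons_left (p := p) Hw d0 d1 mv Iv G0 _ v0).
  move=> s y /andP[s0 s1] /andP[y0 y1].
  by apply: (taylor1 dv dp gG); apply/andP; split=> //; exact: ltW.
by move: Ox; rewrite /Omega /= in_itv/= => /andP[-> _].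
Qed.

(** Reflected into the left layer: [v (1 - x)] has derivative [- p (1 - x)] and vanishes at 0
    because [v 1 = 0]. *)
Let right_layer (x : R) : Om x -> 1 - d < x -> `|Nd w d v x| <= 2 * G + 8 * G * w 0.
Proof.
move=> Ox xd; have Ox' := Om_refl Ox.
have -> : Nd w d v x = Nd w d (fun y => v (1 - y)) (1 - x).
  by rewrite -Nd_refl// subKr.
have Ir := (RI_refl_Omega Iv).1.
apply: (cons_left (p := fun x => - p (1 - x)) Hw d0 d1 (int_meas Ir) Ir G0).
- move=> s y /andP[s0 s1] /andP[y0 y1].
  have := @taylor1 v p g dv dp G (1 - s) (1 - y) gG.
  have -> : 1 - y - (1 - s) = - (y - s) by ring.
  rewrite sqrrN mulrN mulNr; apply; apply/andP; split; lra.
- by rewrite subr0.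
- by move: Ox'; rewrite /Omega /= in_itv/= => /andP[h1 h2]; apply/andP; split; lra.
Qed.

(** Integrable majorant of the squared consistency error: small in the interior, bounded on the
    layers, whose total measure is [2 * d]. *)
Let q (x : R) := (2 * e) ^+ 2 + C1 ^+ 2 * ((0 < x < d)%R%:R + (1 - d < x < 1)%R%:R).

Let q_int : Lint Om q.
Proof.
apply: int_add => //; first by apply: (@int_Om R _ `|(2 * e) ^+ 2|).
apply: int_scale => //; apply: int_add => //; apply: int_natb; exact: itvo_ind_meas.
Qed.

Let q_RI : Rintegral mu Om q = (2 * e) ^+ 2 + C1 ^+ 2 * (2 * d).
Proof.
have Ia : Lint Om (fun x => (0 < x < d)%R%:R) by apply: int_natb; exact: itvo_ind_meas.
have Ib : Lint Om (fun x => (1 - d < x < 1)%R%:R) by apply: int_natb; exact: itvo_ind_meas.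
have Ic : Lint Om (cst ((2 * e) ^+ 2)) by apply: (@int_Om R _ `|(2 * e) ^+ 2|).
have Iab := int_add mO Ia Ib.
rewrite (RintegralD mO Ic (int_scale (C1 ^+ 2) mO Iab)) RI_cst_Omega.
rewrite (RintegralZl (C1 ^+ 2) mO Iab) (RintegralD mO Ia Ib).
have := d0 => d0'; have := d1 => d1'.
rewrite !RI_itvo; [|lra..].
by congr (_ + _ * _); ring.
Qed.

Let add_bnd (a c b : R) : 0 <= a -> 0 <= c -> 0 <= b -> c <= a + c * (1 + b).
Proof. by move=> a0 c0 b0; have := mulr_ge0 c0 b0; lra. Qed.

Let q_bnd (x : R) : Om x -> (g x - Nd w d v x) ^+ 2 <= q x.
Proof.
move=> Ox; have w0 : 0 <= w 0 by apply: (w_ge0 Hw).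
have K0 : 0 <= 2 * G + 8 * G * w 0.
  by apply: addr_ge0; [apply: mulr_ge0|apply: mulr_ge0 => //; apply: mulr_ge0].
have C10 : 0 <= C1 by apply: addr_ge0.
rewrite -(real_normK (num_real _)) distrC /q.
have lay : `|Nd w d v x| <= 2 * G + 8 * G * w 0 -> `|Nd w d v x - g x| ^+ 2 <= C1 ^+ 2.
  move=> h; rewrite ler_pXn2r ?nnegrE//; apply: (le_trans (ler_normB _ _)).
  by rewrite addrC; apply: lerD => //; apply: gG; exact: OmI.
have := Ox; rewrite /Omega /= in_itv/= => /andP[x0 x1].
have [xd|dx] := ltP x d.
  apply: (le_trans (lay (left_layer Ox xd))).
  by rewrite x0 /=; apply: add_bnd; rewrite ?sqr_ge0.
have [xd|xd] := ltP (1 - d) x.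
  apply: (le_trans (lay (right_layer Ox xd))).
  by rewrite x1 /= andbF mulr0n add0r mulr1 lerDr sqr_ge0.
have xx : d <= x <= 1 - d by rewrite dx xd.
rewrite andbF /= addr0 mulr0 addr0 ler_pXn2r ?nnegrE//; first exact: interior.
exact: le_trans (interior Ox xx).
Qed.

Variables (f u : R -> R).
Hypotheses (Lf : L2 f) (Lg : L2 g) (Lu : L2 u).
Hypothesis Nu : {ae mu, forall x : T, Om x -> Nd w d u x = f x}.

(** Stability applied to [u - v], whose image under [Nd] is [(f - g) + (g - Nd v)]. *)
Lemma one_step : coer w ^+ 2 / 4 * Rintegral mu Om (fun x => (u x - v x) ^+ 2) <=
  2 * Rintegral mu Om (fun x => (f x - g x) ^+ 2) + 2 * ((2 * e) ^+ 2 + C1 ^+ 2 * (2 * d)).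
Proof.
have Luv := L2_sub Lu Lv; have /L2P[muv Iuv] := Luv.
have /L2P[_ Ifg] := L2_sub Lf Lg.
have J1 := int_scale 2 mO Ifg; have J2 := int_scale 2 mO q_int.
rewrite -q_RI -(RintegralZl 2 mO Ifg) -(RintegralZl 2 mO q_int) -(RintegralD mO J1 J2).
apply: (stability Hw d0 d1 muv Iuv H2 H3 d2); first exact: int_add.
apply: filterS Nu => x h Ox.
have lin : Nd w d (fun x => u x - v x) x = f x - Nd w d v x.
  rewrite -(h Ox) /Nd.
  have Ku : Lint Om (fun y => u y * Kd w d x y).
    apply: (@eq_int R Om (fun y => Kd w d x y * u y)) => //; first by move=> y _; exact: mulrC.
    exact: (Kv_int Hw d0 d1 ((L2P u).1 Lu).1 ((L2P u).1 Lu).2).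
  have Kv : Lint Om (fun y => v y * Kd w d x y).
    apply: (@eq_int R Om (fun y => Kd w d x y * v y)) => //; first by move=> y _; exact: mulrC.
    exact: (Kv_int Hw d0 d1 ((L2P v).1 Lv).1 ((L2P v).1 Lv).2).
  have -> : Rintegral mu Om (fun y => (u y - v y) * Kd w d x y) =
     Rintegral mu Om (fun y => u y * Kd w d x y) - Rintegral mu Om (fun y => v y * Kd w d x y).
    by rewrite -(RintegralB mO Ku Kv); apply: RI_eq => y _; exact: mulrBl.
  ring.
rewrite lin; apply: (@le_trans _ _ (2 * (f x - g x) ^+ 2 + 2 * (g x - Nd w d v x) ^+ 2)).
  have := sqr_ge0 ((f x - g x) - (g x - Nd w d v x)).
  by move: (f x) (g x) (Nd w d v x) => a b c; nra.
by rewrite lerD2l ler_pM2l//; exact: q_bnd.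
Qed.

End OneStep.

End Main.

(** * Choice of parameters and the limit *)

Section Conclusion.
Variable R : realType.
Local Notation mu := (@lebesgue_measure R).
Local Notation Lint D f := (mu.-integrable D (EFin \o f)).
Local Notation T := (measurableTypeR R).
Local Notation Om := (@Omega R : set T).
Let mO := @mOm R.

Lemma near0_le (c : R) : 0 < c -> \forall d \near (0 : R)^'+, 0 < d <= c.
Proof.
move=> c0; apply: filterS2 (nbhs_right_gt (0 : R)) (nbhs_right_le c0) => d h1 h2.
by rewrite h1 h2.
Qed.

(** Here [U] and [V] are the squared distances of [u] and [u0] to [v], [F] is that of [f] to [g],
    and [s], [X] are the interior and layer parts of the consistency error. Eliminating [U] gives
    [(4 / K + 2) * F + 4 * s / K + 4 * X / K], where each term is at most a third of [E]. *)
Let final_arith (K E F X U V s : R) : 0 < K -> 0 < E ->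
  K * U <= 2 * F + 2 * (s + X) -> V <= F -> F <= E / (3 * (4 / K + 2)) ->
  s <= E * K / 12 -> X <= E * K / 12 -> 2 * U + 2 * V <= E.
Proof.
move=> K0 E0 h1 h2 h3 h4 h5.
have p : 0 < 4 / K + 2 by rewrite addr_gt0// divr_gt0.
have h6 : (4 / K + 2) * F <= E / 3.
  have -> : E / 3 = (4 / K + 2) * (E / (3 * (4 / K + 2))).
    by field; rewrite gt_eqF//= gt_eqF// addr_gt0// mulr_gt0.
  by rewrite ler_pM2l.
have Kv : 0 < K^-1 by rewrite invr_gt0.
have h7 := ler_wpM2l (ltW Kv) h1; rewrite mulKf ?gt_eqF// in h7.
have h8 := ler_wpM2l (ltW Kv) h4; have h9 := ler_wpM2l (ltW Kv) h5.
have e : K^-1 * (E * K / 12) = E / 12 by field; rewrite gt_eqF.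
rewrite e in h8 h9; rewrite mulrDl in h6.
have e1 : 4 / K * F = 4 * (K^-1 * F) by ring.
rewrite e1 in h6.
have e2 : K^-1 * (2 * F + 2 * (s + X)) = 2 * (K^-1 * F) + 2 * (K^-1 * s) + 2 * (K^-1 * X) by ring.
rewrite e2 in h7.
move: (K^-1 * F) (K^-1 * s) (K^-1 * X) h6 h7 h8 h9 => a b c h6 h7 h8 h9; lra.
Qed.

(** For [d <= 1] the square [d^2] may be replaced by [d], which makes the condition linear; the
    summand 1 keeps the divisor positive. *)
Let small_d (d A k c : R) : 0 < d -> d <= 1 -> 0 <= k -> 0 <= c -> 0 < A ->
  d <= A / (k / 128 + c + 1) -> k * d / 128 + c * d ^+ 2 <= A.
Proof.
move=> d0 d1 k0 c0 A0; rewrite ler_pdivlMr; last by lra.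
move=> h; have h1 : c * d ^+ 2 <= c * d by apply: ler_wpM2l => //; rewrite expr2 ler_piMl// ltW.
have : d * (k / 128 + c + 1) = k * d / 128 + c * d + d by ring.
move: h1; move: (c * d ^+ 2) (c * d) (k * d) => x y z; lra.
Qed.

Let small_e (z : R) : 0 < z -> exists2 e' : R, 0 < e' & (2 * e') ^+ 2 <= z / 12.
Proof.
move=> z0; have z1 : 0 < z / 48 by lra.
(* If [z / 48 <= 1], its square is at most itself; for larger [z] the value 1 is already small
   enough. *)
have [h|h] := leP (z / 48) 1; first by exists (z / 48) => //; nra.
by exists 1; [exact: ltr01|lra].
Qed.

Let rate_gt0 (k c A : R) : 0 <= k -> 0 <= c -> 0 < A -> 0 < A / (k / 128 + c + 1).
Proof. by move=> k0 c1 A0; apply: divr_gt0 => //; lra. Qed.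

Let rate2_gt0 (z c : R) : 0 < z -> 0 < z / 12 / (2 * (c ^+ 2 + 1)).
Proof. by move=> z0; have h := sqr_ge0 c; apply: divr_gt0; lra. Qed.

Let rate2_le (z c d : R) : d <= z / 12 / (2 * (c ^+ 2 + 1)) -> 0 < d -> c ^+ 2 * (2 * d) <= z / 12.
Proof.
have h := sqr_ge0 c; rewrite ler_pdivlMr; last by lra.
by move: (c ^+ 2) (z / 12) => x y; nra.
Qed.

(** The order of choices matters: [g], and with it [v], its bounds and [eta], are fixed from [e] and
    the stability constant [K], which does not depend on [d]; only then is [d] made small. *)
Lemma L2dist_cvg (w : R -> R) (f u0 : R -> R) (u : R -> R -> R) :
  A1 w ->
  (forall d : R, 0 < d < 2^-1 -> A2s w d) ->
  (forall d : R, 0 < d < 2^-1 -> A3 w d) ->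
  L2 f ->
  weak_solution f u0 ->
  (exists2 d0 : R, 0 < d0 & forall d : R, 0 < d < d0 ->
     L2 (u d) /\ {ae mu, forall x, Om x -> Nd w d (u d) x = f x}) ->
  forall e : R, 0 < e -> \forall d \near (0 : R)^'+, L2dist (u d) u0 <= e.
Proof.
move=> Hw HA2 HA3 Lf W [du du0 Hu] e e0.
have c0 := coer_gt0 Hw.
have [K KE K0] : exists2 K, K = coer w ^+ 2 / 4 & 0 < K.
  by eexists; first reflexivity; rewrite divr_gt0// exprn_gt0.
have [E EE E0] : exists2 E, E = e ^+ 2 & 0 < E by eexists; first reflexivity; rewrite exprn_gt0.
have F0 : 0 < E / (3 * (4 / K + 2)).
  by rewrite divr_gt0// mulr_gt0// addr_gt0// divr_gt0.
have [g cg hF] := cont_dense Lf F0.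
have [e' e'0 e'1] := small_e (mulr_gt0 E0 K0).
have [G G0 gG] : exists2 M, 0 <= M & forall x : R, 0 <= x <= 1 -> `|g x| <= M.
  by apply: cont_bnd => x _; exact: cg.
have [eta eta0 ge] := unif_cont cg e'0.
have [v [p [[v0 v1 Ip Rp] dv dp vE pE]]] := smooth_sol cg.
have OmI (x : R) : Om x -> 0 <= x <= 1.
  by rewrite /Omega /= in_itv/= => /andP[h1 h2]; rewrite !ltW.
have OmS : Om `<=` `[0, 1]%classic.
  by move=> y /OmI; rewrite /= in_itv.
have dL2 (h dh : R -> R) : (forall x : R, 0 <= x <= 1 -> is_derive x 1 h (dh x)) -> L2 h.
  move=> dh'; have ch (x : R) : 0 <= x <= 1 -> {for x, continuous h}.
    move=> xx; apply: differentiable_continuous; apply/derivable1_diffP.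
    by have [] := dh' x xx.
  have [M M0 hM] := cont_bnd ch.
  apply: (@L2_bnd R _ M) => [|x Ox]; last by apply: hM; exact: OmI.
  by apply: int_meas; apply: integrableS (cont_int ch).
have Lv := dL2 _ _ dv; have Lp := dL2 _ _ dp.
have Lg : L2 g.
  apply: (@L2_bnd R _ G) => [|x Ox]; last by apply: gG; exact: OmI.
  have Ig : Lint (`[0, 1]%classic : set T) g by apply: cont_int => x _; exact: cg.
  by apply: int_meas; apply: integrableS Ig.
have mv : measurable_fun Om v := ((L2P v).1 Lv).1.
have [Lu0 hV] := elliptic cg Ip Lv Lp Lg Rp vE pE Lf W.
have [C1 C1E] : exists C1, C1 = G + (2 * G + 8 * G * w 0) by eexists.
have [A AE A0] : exists2 A, A = 3 / 4 * (7 / 256 * w (15 / 16)) & 0 < A.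
  have wp : 0 < w (15 / 16) by apply: (w_gt0 Hw); apply/andP; split; lra.
  by eexists; first reflexivity; move: (w (15 / 16)) wp => z; lra.
have w2 : 0 <= w (1 / 2) by apply: (w_ge0 Hw).
have D1 := rate_gt0 w2 (ltW c0) A0.
have D2 := rate2_gt0 C1 (mulr_gt0 E0 K0).
have e4 : 0 < (4^-1 : R) by rewrite invr_gt0.
have e41 : (4^-1 : R) <= 1 by lra.
have e42 : (4^-1 : R) < 2^-1 by lra.
have du2 : 0 < du / 2 by rewrite divr_gt0.
(* The five bounds ensure, in this order, disjoint layers, existence of [u d], uniform continuity of
   [g] at scale [d], stability, and a small layer error. *)
apply: filterS (filterI (filterI (near0_le e4) (near0_le du2))
  (filterI (near0_le eta0) (filterI (near0_le D1) (near0_le D2)))).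
move=> d [[/andP[d0 d4] /andP[_ ddu]]] [/andP[_ deta] [/andP[_ dD1] /andP[_ dD2]]].
have d1 : d < 2^-1 := le_lt_trans d4 e42.
have dd : 0 < d < 2^-1 by rewrite d0 d1.
have ddu' : 0 < d < du by rewrite d0 (le_lt_trans ddu)// gtr_pMr// invf_lt1// ltr1n.
have [Lu Nu] := Hu d ddu'.
have h2 := small_d d0 (le_trans d4 e41) w2 (ltW c0) A0 dD1.
rewrite AE in h2.
have step := one_step Hw d0 d1 (HA2 d dd) (HA3 d dd) h2 dv dp v0 v1 gG ge deta Lv Lf Lg Lu Nu.
rewrite -KE -C1E in step; have hX := rate2_le dD2 d0.
have fin := final_arith K0 E0 step hV hF e'1 hX.
have /L2P[_ I1] := L2_sub Lu Lv; have /L2P[_ I2] := L2_sub Lu0 Lv; have /L2P[_ I3] := L2_sub Lu Lu0.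
have J1 := int_scale 2 mO I1; have J2 := int_scale 2 mO I2.
rewrite /L2dist -(ger0_norm (ltW e0)) -sqrtr_sqr -EE; apply: ler_wsqrtr; apply: le_trans fin.
rewrite -(RintegralZl 2 mO I1) -(RintegralZl 2 mO I2) -(RintegralD mO J1 J2).
apply: le_Rintegral => //; first exact: int_add.
move=> x _; have := sqr_ge0 ((u d x - v x) + (u0 x - v x)).
by move: (u d x) (u0 x) (v x) => a b c; nra.
Qed.

End Conclusion.

Theorem mainTheorem9 (R : realType) (w : R -> R) (f u0 : R -> R) (u : R -> R -> R) :
  A1 w ->
  (forall d : R, 0 < d < 2^-1 -> A2s w d) ->
  (forall d : R, 0 < d < 2^-1 -> A3 w d) ->
  L2 f ->
  weak_solution f u0 ->
  (exists2 d0 : R, 0 < d0 & forall d : R, 0 < d < d0 ->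
     L2 (u d) /\ {ae (@lebesgue_measure R), forall x, Omega x -> Nd w d (u d) x = f x}) ->
  L2dist (u d) u0 @[d --> 0^'+] --> 0.
Proof.
move=> Hw H2 H3 Lf W Hu; apply/cvgrPdist_le => e e0.
apply: filterS (L2dist_cvg Hw H2 H3 Lf W Hu e0) => d h.
by rewrite sub0r normrN ger0_norm// /L2dist sqrtr_ge0.
Qed.
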